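(* Let $A\subseteq\mathbf{M}$ be finite and $X=\mathrm{gcl}(A)$, considered as an induced subgraph of $\mathbf{M}$. Then $\mathrm{Aut}_A(X)=\{g\in\mathrm{Aut}(X):g(a)=a\text{ for all }a\in A\}$ has the small index property, and hence $\mathrm{Aut}(X)$ has the small index property.
   Context: Fix $\mathfrak{m}\ge2$. Graphs, $\delta(A)=\mathfrak{m}|A|-|\mathcal{R}(A)|$ ($\mathcal{R}(A)$ the edge set), $A\leqslant B$ iff $\delta(A')\ge\delta(A)$ for all $A\subseteq A'\subseteq B$ (for infinite $N$: $A\leqslant B$ for all finite $B\subseteq N$ containing $A$). $\mathsf{K_0}$ = finite graphs all of whose subgraphs have $\delta\ge0$. $\mathbf{M}$ is the $(\mathsf{K_0},\leqslant)$-generic: unique countable graph that is a union of a chain of finite $\leqslant$-closed subsets, in which isomorphisms between finite $\leqslant$-closed subsets extend to automorphisms, and into which every member of $\mathsf{K_0}$ embeds $\leqslant$-closedly. $\mathrm{cl}(A)$ is the smallest finite $\leqslant$-closed subset of $\mathbf{M}$ containing finite $A$; $\mathrm{d}(A)=\delta(\mathrm{cl}(A))$; $\mathrm{d}(m/A)=\mathrm{d}(\{m\}\cup A)-\mathrm{d}(A)$; $\mathrm{gcl}(X)=\{m:\mathrm{d}(m/A)=0$ for some finite $A\subseteq X\}$. Automorphism groups carry the topology of pointwise convergence; a group has the small index property if every subgroup of index $<2^{\aleph_0}$ is open. *)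

(* Defs.v *)
(* The generic graph M is modelled as a graph on nat
   (M is countable), with a boolean edge relation e.  Finite subsets are
   duplicate-free lists of vertices. *)
From Stdlib Require Import ZArith List Arith Permutation.
Import ListNotations.
Open Scope Z_scope.

Definition nedges (e : nat -> nat -> bool) (A : list nat) : nat :=
  length (filter (fun p => andb (Nat.ltb (fst p) (snd p)) (e (fst p) (snd p)))
                 (list_prod A A)).

Definition delta (m : nat) (e : nat -> nat -> bool) (A : list nat) : Z :=
  Z.of_nat (m * length A) - Z.of_nat (nedges e A).

Definition is_graph (e : nat -> nat -> bool) : Prop :=
  (forall x y, e x y = e y x) /\ (forall x, e x x = false).

Definition fin_le m e (A B : list nat) : Prop :=
  NoDup A /\ NoDup B /\ incl A B /\
  forall A', NoDup A' -> incl A A' -> incl A' B -> delta m e A <= delta m e A'.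

Definition closed_in m e (A : list nat) (N : nat -> Prop) : Prop :=
  NoDup A /\ (forall x, In x A -> N x) /\
  forall B, NoDup B -> incl A B -> (forall x, In x B -> N x) -> fin_le m e A B.

Definition closed_M m e (A : list nat) : Prop := closed_in m e A (fun _ => True).

Definition in_K0 (m n : nat) (e' : nat -> nat -> bool) : Prop :=
  (forall x y, (x < n)%nat -> (y < n)%nat -> e' x y = e' y x) /\
  (forall x, (x < n)%nat -> e' x x = false) /\
  forall A, NoDup A -> (forall x, In x A -> (x < n)%nat) -> 0 <= delta m e' A.

Definition is_automorphism (e : nat -> nat -> bool) (g : nat -> nat) : Prop :=
  (forall x y, g x = g y -> x = y) /\ (forall y, exists x, g x = y) /\
  (forall x y, e (g x) (g y) = e x y).

Definition is_generic (m : nat) (e : nat -> nat -> bool) : Prop :=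
  is_graph e /\
  (forall A, NoDup A -> 0 <= delta m e A) /\
  (exists C : nat -> list nat,
      (forall n, closed_M m e (C n)) /\ (forall n, incl (C n) (C (S n))) /\
      (forall x, exists n, In x (C n))) /\
  (forall (A B : list nat) (f : nat -> nat),
      closed_M m e A -> closed_M m e B -> Permutation (map f A) B ->
      (forall x y, In x A -> In y A -> e (f x) (f y) = e x y) ->
      exists g, is_automorphism e g /\ forall x, In x A -> g x = f x) /\
  (forall (n : nat) (e' : nat -> nat -> bool), in_K0 m n e' ->
      exists f : nat -> nat,
        (forall x y, (x < n)%nat -> (y < n)%nat -> f x = f y -> x = y) /\
        (forall x y, (x < n)%nat -> (y < n)%nat -> e (f x) (f y) = e' x y) /\
        closed_M m e (map f (seq 0 n))).

Definition is_cl m e (A C : list nat) : Prop :=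
  closed_M m e C /\ incl A C /\
  forall D, closed_M m e D -> incl A D -> incl C D.

(* x in gcl(X): d(x/A0) = 0 for some finite A0 subset X,
   where d(B) = delta(cl(B)) *)
Definition in_gcl m e (X : nat -> Prop) (x : nat) : Prop :=
  exists (A0 C C' : list nat),
    (forall a, In a A0 -> X a) /\ is_cl m e A0 C /\ is_cl m e (x :: A0) C' /\
    delta m e C' = delta m e C.

(* automorphisms of the induced subgraph on X, as functions nat -> nat
   (only their values on X matter) *)
Definition eq_on (X : nat -> Prop) (f g : nat -> nat) : Prop :=
  forall x, X x -> f x = g x.

Definition is_aut_on (e : nat -> nat -> bool) (X : nat -> Prop) (g : nat -> nat) : Prop :=
  (forall x, X x -> X (g x)) /\
  (forall x y, X x -> X y -> g x = g y -> x = y) /\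
  (forall y, X y -> exists x, X x /\ g x = y) /\
  (forall x y, X x -> X y -> e (g x) (g y) = e x y).

(* H is a subgroup of the group G (both acting on X, elements identified
   when they agree on X) *)
Definition is_subgroup (X : nat -> Prop) (G H : (nat -> nat) -> Prop) : Prop :=
  (forall g, H g -> G g) /\
  (forall g g', H g -> eq_on X g g' -> H g') /\
  H (fun x => x) /\
  (forall g h, H g -> H h -> H (fun x => g (h x))) /\
  (forall g, H g -> exists h, H h /\ eq_on X (fun x => g (h x)) (fun x => x)).

(* [G : H] < 2^aleph_0 : there is no family of continuum many elements of G
   lying in pairwise distinct left cosets of H *)
Definition index_lt_continuum (X : nat -> Prop) (G H : (nat -> nat) -> Prop) : Prop :=
  ~ exists phi : (nat -> bool) -> (nat -> nat),
      (forall s, G (phi s)) /\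
      forall s t, s <> t ->
        ~ exists h, H h /\ eq_on X (phi t) (fun x => phi s (h x)).

(* H is open in G (topology of pointwise convergence on X) : H contains the
   pointwise stabiliser in G of some finite subset of X *)
Definition is_open_sub (X : nat -> Prop) (G H : (nat -> nat) -> Prop) : Prop :=
  exists F : list nat, (forall x, In x F -> X x) /\
    forall g, G g -> (forall x, In x F -> g x = x) -> H g.

Definition small_index_property (X : nat -> Prop) (G : (nat -> nat) -> Prop) : Prop :=
  forall H, is_subgroup X G H -> index_lt_continuum X G H -> is_open_sub X G H.

(* Main.v *)
Require Import Defs.
From Stdlib Require Import ZArith List Arith Lia Permutation Cantor.
From Stdlib Require Import Classical ClassicalEpsilon FunctionalExtensionality ProofIrrelevance.
Import ListNotations.
Local Open Scope nat_scope.
Local Open Scope bool_scope.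

(** Let C0 = cl(A).  The finite sets B containing C0 with delta(B) = delta(C0) are closed under
    union and intersection, any two of them are freely amalgamated over their intersection, and
    their union is gcl(A).  So every point x outside C0 has a least such set below it, and
    closure is disintegrated: an edge only joins points one of which lies below the other.
    By genericity of M, a finite injection that is locally induced by automorphisms over C0 is
    induced by one, and finite closed sets can be moved off each other freely.  These facts
    (record [layered]) suffice for the small index property of the stabiliser of C0, which is
    open both in Aut_A(X) and in Aut(X).

    Partial automorphisms extend to automorphisms of a larger finite closed set: one proceeds by
    induction on the number of points below a point, where at each level only permutations of
    finitely many disjoint blocks have to be completed.  Hence for every n the locally finite
    generic n-tuples are extended by comeagrely many elements, and two generic tuples agreeing on a
    finite invariant set F are conjugate over F.  If H has index less than the continuum and is
    not open, then H and its complement both contain such extensions arbitrarily close to 1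
    (a family of continuum many elements with all quotients g_s^-1 g_t generic meets H; an element
    outside H is a product of two generic ones).  Iterating along the binary tree as in Kechris
    and Rosendal gives continuum many h_s such that, for distinct s and t, some u in H and v
    outside H satisfy h_s u h_s^-1 = h_t v h_t^-1 (up to exchanging s and t); hence
    h_s^-1 h_t is not in H, a contradiction. *)

(** * Layered permutation groups and extension of partial automorphisms *)

Record perm (T : Type) := Perm {
  pfun :> T -> T;
  pbck : T -> T;
  pfunK : forall x, pbck (pfun x) = x;
  pbckK : forall x, pfun (pbck x) = x }.
Arguments Perm {T}.
Arguments pfun {T}.
Arguments pbck {T}.
Arguments pfunK {T}.
Arguments pbckK {T}.

Lemma perm_ext {T} (p q : perm T) : (forall x, p x = q x) -> p = q.
Proof.
  destruct p as [f f' H1 H2], q as [g g' H3 H4]; simpl; intros E.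
  assert (f = g) by (apply functional_extensionality; auto); subst g.
  assert (f' = g').
  { apply functional_extensionality; intros x.
    rewrite <- (H4 x) at 1. apply H1. }
  subst g'. f_equal; apply proof_irrelevance.
Qed.

Definition pid {T} : perm T := Perm (fun x => x) (fun x => x) (fun x => eq_refl) (fun x => eq_refl).

Program Definition pinv {T} (p : perm T) : perm T := Perm (pbck p) (pfun p) _ _.
Next Obligation. apply pbckK. Qed.
Next Obligation. apply pfunK. Qed.

Program Definition pcomp {T} (p q : perm T) : perm T :=
  Perm (fun x => p (q x)) (fun x => pbck q (pbck p x)) _ _.
Next Obligation. now rewrite !pfunK. Qed.
Next Obligation. now rewrite !pbckK. Qed.

Notation "p ** q" := (pcomp p q) (at level 40, left associativity).

Lemma perm_inj {T} (p : perm T) x y : p x = p y -> x = y.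
Proof. intros H. rewrite <- (pfunK p x), <- (pfunK p y). now f_equal. Qed.

Lemma pinvK {T} (p : perm T) x : pinv p (p x) = x.
Proof. apply pfunK. Qed.

Lemma pinvVK {T} (p : perm T) x : p (pinv p x) = x.
Proof. apply pbckK. Qed.

Lemma pinv_eq {T} (p : perm T) x y : p x = y -> pinv p y = x.
Proof. intros <-. apply pinvK. Qed.

Definition agree {T} (D : list T) (g h : perm T) := forall x, In x D -> g x = h x.
Definition fixes {T} (D : list T) (g : perm T) := forall x, In x D -> g x = x.

Lemma agree_sub {T} (D E : list T) g h : incl D E -> agree E g h -> agree D g h.
Proof. firstorder. Qed.

Lemma in_dec_c {T} (x : T) l : {In x l} + {~ In x l}.
Proof. apply excluded_middle_informative. Qed.

Lemma eq_dec_c {T} (x y : T) : {x = y} + {x <> y}.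
Proof. apply excluded_middle_informative. Qed.

Definition sel {T} (P : T -> Prop) (l : list T) : list T :=
  filter (fun x => if excluded_middle_informative (P x) then true else false) l.

Lemma sel_In {T} (P : T -> Prop) l x : In x (sel P l) <-> In x l /\ P x.
Proof.
  unfold sel. rewrite filter_In.
  destruct (excluded_middle_informative (P x)); intuition congruence.
Qed.

Lemma sel_length_lt {T} (P Q : T -> Prop) l x :
  In x l -> P x -> ~ Q x -> (forall y, Q y -> P y) ->
  length (sel Q l) < length (sel P l).
Proof.
  intros Hx HP HQ HS.
  assert (Hle : forall l, length (sel Q l) <= length (sel P l)).
  { clear - HS. induction l as [|a l IH]; unfold sel in *; simpl; auto.
    destruct (excluded_middle_informative (Q a)), (excluded_middle_informative (P a));
      simpl; try lia. exfalso; auto. }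
  induction l as [|a l IH]; [destruct Hx|].
  specialize (Hle l). unfold sel in *; simpl.
  destruct Hx as [->|Hx].
  - destruct (excluded_middle_informative (Q x)); [contradiction|].
    destruct (excluded_middle_informative (P x)); [simpl; lia|contradiction].
  - specialize (IH Hx).
    destruct (excluded_middle_informative (Q a)), (excluded_middle_informative (P a));
      simpl; try lia. exfalso; auto.
Qed.

(** [dn x] is the finite set of points below [x]. This is a preorder only: distinct points may lie
    below each other and then form a block. [c] witnesses countability. [G_hom] says that all
    structure sits inside the sets [dn x], so down-closed sets amalgamate freely; [G_move] provides
    disjoint copies over a down-closed set; [G_closed] keeps limits of approximations in [G]. *)
Record layered {T : Type} (c : T -> nat) (dn : T -> list T) (G : perm T -> Prop) : Prop := {
  code_inj : forall x y, c x = c y -> x = y;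
  dn_nodup : forall x, NoDup (dn x);
  dn_refl : forall x, In x (dn x);
  dn_trans : forall x y, In y (dn x) -> incl (dn y) (dn x);
  G_id : G pid;
  G_comp : forall g h, G g -> G h -> G (g ** h);
  G_inv : forall g, G g -> G (pinv g);
  G_dn : forall g x y, G g -> In y (dn x) -> In (g y) (dn (g x));
  G_hom : forall D (f : T -> T),
    (forall x, In x D -> incl (dn x) D) ->
    (forall x y, In x D -> In y D -> f x = f y -> x = y) ->
    (forall x, In x D -> exists g, G g /\ forall y, In y (dn x) -> f y = g y) ->
    exists g, G g /\ forall x, In x D -> f x = g x;
  G_move : forall D E, (forall x, In x D -> incl (dn x) D) ->
    exists g, G g /\ fixes D g /\ forall x, In x E -> ~ In x D -> ~ In (g x) E;
  G_closed : forall g, (forall D, exists h, G h /\ agree D g h) -> G g }.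

Section Layered.

Context {T : Type} {c : T -> nat} {dn : T -> list T} {G : perm T -> Prop}.
Hypothesis L : layered c dn G.

Definition down (D : list T) := forall x, In x D -> incl (dn x) D.
Definition dcl (D : list T) := flat_map dn D.

Lemma dcl_down D : down (dcl D).
Proof.
  intros x Hx y Hy. unfold dcl in *. rewrite in_flat_map in *.
  destruct Hx as [z [Hz Hx]]. exists z; split; auto.
  apply (dn_trans _ _ _ L z x); auto.
Qed.

Lemma dcl_incl D : incl D (dcl D).
Proof.
  intros x Hx. unfold dcl. rewrite in_flat_map. exists x; split; auto.
  apply (dn_refl _ _ _ L).
Qed.

Lemma down_dn x : down (dn x).
Proof. intros y Hy. now apply (dn_trans _ _ _ L). Qed.

Lemma down_app D E : down D -> down E -> down (D ++ E).
Proof.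
  intros HD HE x Hx y Hy. rewrite in_app_iff in *.
  destruct Hx as [Hx|Hx]; [left; exact (HD x Hx y Hy)|right; exact (HE x Hx y Hy)].
Qed.

Lemma down_map D g : G g -> down D -> down (map g D).
Proof.
  intros Hg HD x Hx y Hy. apply in_map_iff in Hx. destruct Hx as [z [<- Hz]].
  apply in_map_iff. exists (pinv g y). split; [apply pinvVK|].
  apply (HD z Hz). rewrite <- (pinvK g z).
  apply (G_dn _ _ _ L); auto. now apply (G_inv _ _ _ L).
Qed.

Definition lev x := length (dn x).

Lemma lev_le x y : In y (dn x) -> lev y <= lev x.
Proof.
  intros H. apply NoDup_incl_length; [apply (dn_nodup _ _ _ L)|].
  now apply (dn_trans _ _ _ L).
Qed.

(** [dn y] is contained in [dn x] and not shorter, so both have the same members. Comparable points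
    of one level thus form a block. *)
Lemma lev_eq x y : In y (dn x) -> lev x <= lev y -> In x (dn y).
Proof.
  intros H Hl.
  apply (NoDup_length_incl (dn_nodup _ _ _ L y) Hl (dn_trans _ _ _ L _ _ H)).
  apply (dn_refl _ _ _ L).
Qed.

Lemma lev_G g x : G g -> lev (g x) = lev x.
Proof.
  assert (A : forall g x, G g -> lev x <= lev (g x)).
  { clear g x. intros g x Hg. unfold lev.
    rewrite <- (length_map g (dn x)).
    apply NoDup_incl_length.
    - apply FinFun.Injective_map_NoDup; [|apply (dn_nodup _ _ _ L)].
      intros a b; apply perm_inj.
    - intros y Hy. apply in_map_iff in Hy. destruct Hy as [z [<- Hz]].
      now apply (G_dn _ _ _ L). }
  intros Hg. apply Nat.le_antisymm; [|auto].
  rewrite <- (pinvK g x) at 2. apply A. now apply (G_inv _ _ _ L).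
Qed.

(** Every point of the union has its whole down-set in [A] or in [B], so the local condition of
    [G_hom] is met by [g] or by [h]; what remains is agreement on the overlap and injectivity across
    the two sets. *)
Lemma glue A B g h : down A -> down B -> G g -> G h ->
  (forall x, In x A -> In x B -> g x = h x) ->
  (forall x y, In x A -> In y B -> g x = h y -> x = y) ->
  exists k, G k /\ agree A k g /\ agree B k h.
Proof.
  intros HA HB Hg Hh Hag Hinj.
  set (f := fun x => if in_dec_c x A then g x else h x).
  assert (fA : forall x, In x A -> f x = g x).
  { intros x Hx. unfold f. destruct (in_dec_c x A); tauto. }
  assert (fB : forall x, In x B -> f x = h x).
  { intros x Hx. unfold f. destruct (in_dec_c x A); auto. }
  destruct (G_hom _ _ _ L (A ++ B) f) as [k [Hk E]].
  - now apply down_app.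
  - intros x y Hx Hy. rewrite in_app_iff in *.
    destruct Hx as [Hx|Hx], Hy as [Hy|Hy];
      rewrite ?(fA _ Hx), ?(fA _ Hy), ?(fB _ Hx), ?(fB _ Hy); intros E.
    + now apply perm_inj in E.
    + eauto.
    + symmetry; eauto.
    + now apply perm_inj in E.
  - intros x Hx. rewrite in_app_iff in Hx. destruct Hx as [Hx|Hx].
    + exists g; split; auto. intros y Hy. apply fA. eapply HA; eauto.
    + exists h; split; auto. intros y Hy. apply fB. eapply HB; eauto.
  - exists k. split; auto. split; intros x Hx.
    + rewrite <- fA by auto. symmetry. apply E. rewrite in_app_iff; auto.
    + rewrite <- fB by auto. symmetry. apply E. rewrite in_app_iff; auto.
Qed.

Fixpoint piter (n : nat) (g : perm T) : perm T :=
  match n with 0 => pid | S n => g ** piter n g end.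

Lemma piter_G n g : G g -> G (piter n g).
Proof.
  intros Hg; induction n; simpl; [apply (G_id _ _ _ L)|].
  now apply (G_comp _ _ _ L).
Qed.

Lemma piter_fixes n g D : fixes D g -> fixes D (piter n g).
Proof.
  intros Hg; induction n; simpl; intros x Hx; auto.
  simpl. rewrite IHn; auto.
Qed.

Lemma piter_add n k g x : piter (n + k) g x = piter n g (piter k g x).
Proof. induction n; simpl; auto. now rewrite IHn. Qed.

(** An orbit staying in the finite set [A] from its first step on repeats a value; cancelling [s] in
    the repetition makes [x] one of the later iterates, hence a member of [A]. *)
Lemma escape (D A : list T) (s : perm T) x : ~ In x A -> In x D -> incl A D ->
  exists j, In (piter j s x) D /\ ~ In (s (piter j s x)) A /\
    forall i, i < j -> In (piter (S i) s x) A.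
Proof.
  intros Hx HxD HAD.
  assert (Hex : exists j, ~ In (piter (S j) s x) A).
  { apply NNPP. intros Hn.
    assert (Hall : forall j, In (piter (S j) s x) A).
    { intros j. apply NNPP. intros H. apply Hn. eauto. }
    set (l := map (fun j => piter (S j) s x) (seq 0 (S (length A)))).
    assert (Hdup : ~ NoDup l).
    { intros Hnd. assert (H : incl l A).
      { intros y Hy. apply in_map_iff in Hy. destruct Hy as [j [<- _]]. auto. }
      pose proof (NoDup_incl_length Hnd H) as Hl. unfold l in Hl.
      rewrite length_map, length_seq in Hl. lia. }
    apply Hdup. apply FinFun.Injective_map_NoDup; [|apply seq_NoDup].
    assert (Hlt : forall i j, i < j -> piter (S i) s x = piter (S j) s x -> False).
    { intros i j Hij E. apply Hx.
      replace (S j) with (S i + (j - i)) in E by lia.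
      rewrite piter_add in E. apply perm_inj in E. rewrite E.
      replace (j - i) with (S (j - i - 1)) by lia. apply Hall. }
    intros i j E. destruct (lt_eq_lt_dec i j) as [[H|H]|H]; auto; exfalso.
    - exact (Hlt _ _ H E).
    - exact (Hlt _ _ H (eq_sym E)). }
  destruct Hex as [j0 Hj0].
  assert (Hmin : exists j, ~ In (piter (S j) s x) A /\ forall i, i < j -> In (piter (S i) s x) A).
  { clear - Hj0. induction j0 as [j0 IH] using lt_wf_ind.
    destruct (classic (exists i, i < j0 /\ ~ In (piter (S i) s x) A)) as [[i [Hi H]]|H].
    - eauto.
    - exists j0; split; auto. intros i Hi. apply NNPP. intros Hn. apply H; eauto. }
  destruct Hmin as [j [Hj Hi]]. exists j. split; [|split; auto].
  destruct j as [|j]; simpl; auto. apply HAD. apply (Hi j). lia.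
Qed.

(* Partial maps over D0 are completed by closing each chain of blocks into a
   cycle: a block outside the domain goes to the start of its chain. *)
Lemma flat_extend D D0 : down D -> down D0 ->
  (forall x y, In x D -> ~ In x D0 -> In y (dn x) -> ~ In y D0 -> In x (dn y)) ->
  forall A r, down A -> incl D0 A -> incl A D -> G r -> fixes D0 r ->
  (forall x, In x A -> In (r x) D) ->
  exists R, G R /\ agree A R r /\ forall x, In x D -> In (R x) D.
Proof.
  intros HD HD0 Hflat A.
  remember (length (sel (fun x => ~ In x A) D)) as n eqn:En.
  revert A En. induction n as [n IH] using lt_wf_ind. intros A En r HA H0A HAD Hr Hfix HrD.
  destruct (classic (incl D A)) as [HDA|HDA].
  { exists r. repeat split; auto. }
  assert (Hx : exists x, In x D /\ ~ In x A).
  { apply NNPP. intros H. apply HDA. intros x Hx. apply NNPP. intros Hn. apply H; eauto. }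
  destruct Hx as [x [HxD HxA]].
  (* The chain is followed backwards from [x]: [t x] is the first point reached that has no preimage
     in [A] under [r]. Mapping the block of [x] there by [t] closes the chain. *)
  set (s := pinv r). assert (Hs : G s) by now apply (G_inv _ _ _ L).
  destruct (escape D A s x HxA HxD HAD) as [j [HjD [Hj Hi]]].
  set (t := piter j s) in *.
  assert (Ht : G t) by now apply piter_G.
  assert (Htf : fixes D0 t).
  { apply piter_fixes. intros y Hy. apply pinv_eq. auto. }
  (* By flatness [x] lies below each such [z], so a preimage of [t z] in the down-closed [A] would
     bring one of [t x] along. The target block is therefore free. *)
  assert (HtA : forall z, In z (dn x) -> ~ In z D0 -> ~ In (s (t z)) A).
  { intros z Hz Hz0 HzA. apply Hj. apply (HA _ HzA).
    apply (G_dn _ _ _ L); auto. apply (G_dn _ _ _ L); auto. }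
  destruct (glue A (dn x) r t) as [r' [Hr' [EA Ex]]]; auto.
  - apply down_dn.
  - intros y HyA Hyx. destruct (classic (In y D0)) as [Hy|Hy].
    + rewrite Htf, Hfix; auto.
    + exfalso. apply HxA. apply (HA y); auto.
  - intros y z HyA Hzx E. destruct (classic (In z D0)) as [Hz|Hz].
    + rewrite Htf in E by auto. rewrite <- (Hfix z) in E by auto. now apply perm_inj in E.
    + exfalso. apply (HtA z); auto. rewrite <- E. unfold s. now rewrite pinvK.
  - destruct (IH (length (sel (fun y => ~ In y (A ++ dn x)) D))) with (A := A ++ dn x) (r := r')
      as [R [HR [ER HRD]]]; auto.
    + rewrite En. apply sel_length_lt with (x := x); auto.
      * rewrite in_app_iff. intros H. apply H. right. apply (dn_refl _ _ _ L).
      * intros y Hy Hy'. apply Hy. rewrite in_app_iff; auto.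
    + apply down_app; auto. apply down_dn.
    + intros y Hy. rewrite in_app_iff; auto.
    + apply incl_app; auto.
    + intros y Hy. rewrite EA; auto.
    + intros y Hy. rewrite in_app_iff in Hy. destruct Hy as [Hy|Hy].
      * rewrite EA; auto.
      * rewrite Ex by auto. apply (HD (t x)); auto. now apply (G_dn _ _ _ L).
    + exists R. repeat split; auto. intros y Hy. rewrite ER, EA; auto.
      rewrite in_app_iff; auto.
Qed.

Fixpoint words (n : nat) (D : list T) : list (list T) :=
  match n with
  | 0 => [[]]
  | S n => flat_map (fun x => map (cons x) (words n D)) D
  end.

Lemma words_In D l : incl l D -> In l (words (length l) D).
Proof.
  induction l as [|a l IH]; intros H; simpl; auto.
  apply in_flat_map. exists a. split; [apply H; simpl; auto|].
  apply in_map. apply IH. intros x Hx. apply H. simpl; auto.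
Qed.

(** An injection of a finite set into itself is onto; duplicates in [D] are removed before
    counting. *)
Lemma stable_rev (D : list T) (q : perm T) :
  (forall x, In x D -> In (q x) D) -> forall x, In (q x) D -> In x D.
Proof.
  intros H x Hx.
  assert (Hi : incl D (map q (nodup eq_dec_c D))).
  { intros y Hy. apply (@NoDup_length_incl _ (map q (nodup eq_dec_c D)) (nodup eq_dec_c D)).
    - apply FinFun.Injective_map_NoDup; [|apply NoDup_nodup]. intros a b; apply perm_inj.
    - now rewrite length_map.
    - intros z Hz. apply in_map_iff in Hz. destruct Hz as [a [<- Ha]].
      rewrite nodup_In in *. auto.
    - now rewrite nodup_In. }
  apply Hi, in_map_iff in Hx. destruct Hx as [y [E Hy]].
  apply perm_inj in E. subst y. now rewrite nodup_In in Hy.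
Qed.

(** A restriction to [D0] is coded by the list of images of [D0]. Copies of [E] are placed one at a
    time, each new one moved over [D0] away from all earlier ones. *)
Lemma place_copies D0 E (I : list (list T)) : down D0 -> NoDup I ->
  (forall w, In w I -> exists q, G q /\ map q D0 = w /\ forall x, In x D0 -> In (q x) D0) ->
  exists h : list T -> perm T, forall w, In w I ->
    G (h w) /\ map (h w) D0 = w /\
    forall w' x x', In w' I -> In x E -> In x' E -> h w x = h w' x' -> w = w' \/ In x D0.
Proof.
  intros HD0. induction I as [|w I IH]; intros HI Hq.
  { exists (fun _ => pid). simpl; tauto. }
  inversion HI as [|? ? Hw HI']; subst.
  destruct IH as [h Hh]; auto. { intros; apply Hq; simpl; auto. }
  destruct (Hq w) as [q [HG [Hqw HqD]]]; [simpl; auto|].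
  destruct (G_move _ _ _ L D0 (map q E ++ flat_map (fun w => map (h w) E) I)) as [k [Hk [Hkf Hkm]]]; auto.
  assert (Hkq : forall x w' x', In x E -> In w' I -> In x' E -> k (q x) = h w' x' -> In (q x) D0).
  { intros x w' x' Hx Hw' Hx' E'. apply NNPP. intros Hn.
    apply (Hkm (q x)); auto.
    - rewrite in_app_iff. left. now apply in_map.
    - rewrite in_app_iff. right. rewrite E'. apply in_flat_map. exists w'; split; auto.
      now apply in_map. }
  exists (fun v => if eq_dec_c v w then k ** q else h v).
  intros v Hv. destruct (eq_dec_c v w) as [->|Hvw].
  - split; [now apply (G_comp _ _ _ L)|]. split.
    { rewrite <- Hqw. apply map_ext_in. intros x Hx. simpl. apply Hkf. auto. }
    intros w' x x' Hw' Hx Hx' E'. destruct (eq_dec_c w' w) as [->|Hne]; auto.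
    right. apply (stable_rev D0 q); auto. apply (Hkq x w' x'); auto.
    destruct Hw'; congruence.
  - destruct Hv as [Hv|Hv]; [congruence|]. destruct (Hh v Hv) as [H1 [H2 H3]].
    split; auto. split; auto. intros w' x x' Hw' Hx Hx' E'.
    destruct (eq_dec_c w' w) as [->|Hne].
    + right. assert (Hx0 : In (q x') D0) by now apply (Hkq x' v x).
      apply (stable_rev D0 (h v)).
      * destruct (Hq v) as [q' [_ [Hq' Hq'D]]]; [simpl; auto|].
        assert (Hsub : incl v D0).
        { rewrite <- Hq'. intros z Hz. apply in_map_iff in Hz. destruct Hz as [u [<- Hu]]. auto. }
        intros y Hy. apply Hsub. rewrite <- H2 at 2. now apply in_map.
      * rewrite E'. simpl. now rewrite Hkf.
    + apply (H3 w' x x'); auto. destruct Hw'; congruence.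
Qed.

(* The finite group of restrictions to D0 is made to act on one disjoint copy
   of E over D0 for each of its elements. *)
Lemma stabiliser_lifts D0 E : down D0 -> down E -> incl D0 E ->
  exists D, down D /\ incl E D /\
    (forall y, In y D -> exists g x, G g /\ (forall z, In z D0 <-> In (g z) D0) /\ In x E /\ y = g x) /\
    forall q, G q -> (forall x, In x D0 -> In (q x) D0) ->
      exists P, G P /\ agree D0 P q /\ forall x, In x D -> In (P x) D.
Proof.
  intros HD0 HE H0E.
  set (stab := fun q => G q /\ forall x, In x D0 -> In (q x) D0).
  set (I := nodup eq_dec_c (sel (fun w => exists q, stab q /\ map q D0 = w) (words (length D0) D0))).
  assert (HI : forall w, In w I <-> exists q, stab q /\ map q D0 = w).
  { intros w. unfold I. rewrite nodup_In, sel_In. split; [tauto|].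
    intros H; split; auto. destruct H as [q [[_ Hq] <-]].
    rewrite <- (length_map q D0) at 1. apply words_In.
    intros y Hy. apply in_map_iff in Hy. destruct Hy as [x [<- Hx]]. auto. }
  destruct (place_copies D0 E I) as [h0 Hh0]; auto.
  { apply NoDup_nodup. }
  { intros w Hw. apply HI in Hw. destruct Hw as [q [[? ?] ?]]. eauto. }
  (* The word [D0] codes the identity. Dividing all copies by its placement [p], which fixes [D0]
     pointwise, makes the copy of the identity equal to [E] itself. *)
  set (p := h0 D0).
  assert (H1 : In D0 I).
  { apply HI. exists pid. split; [split; auto; apply (G_id _ _ _ L)|]. apply map_id. }
  assert (Hmap : forall (f g : perm T), map f D0 = map g D0 <-> agree D0 f g).
  { intros f g. split.
    - intros Hm x Hx. now apply (proj1 map_ext_in_iff Hm).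
    - intros Hm. apply map_ext_in. auto. }
  assert (Hp : G p /\ fixes D0 p).
  { destruct (Hh0 D0 H1) as [Hp [Hm _]]. split; auto.
    intros x Hx. change x with (pid x) at 2. apply (proj1 (Hmap p pid)); auto.
    unfold p. rewrite Hm. symmetry. apply map_id. }
  set (h := fun w => pinv p ** h0 w).
  assert (Hpi : fixes D0 (pinv p)).
  { intros x Hx. apply pinv_eq. now apply Hp. }
  assert (Hh0D : forall w x, In w I -> In x D0 -> In (h0 w x) D0).
  { intros w x Hw Hx. destruct (Hh0 w Hw) as [_ [Hm _]]. apply HI in Hw.
    destruct Hw as [q [[_ Hq] Hqw]]. rewrite <- Hqw in Hm at 2.
    rewrite (proj1 (Hmap _ _) Hm) by auto. auto. }
  assert (Hh : forall w x, In w I -> In x D0 -> h w x = h0 w x).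
  { intros w x Hw Hx. change (pinv p (h0 w x) = h0 w x). auto. }
  assert (Hst : forall w, In w I -> stab (h w)).
  { intros w Hw. split.
    - apply (G_comp _ _ _ L); [|now apply Hh0]. apply (G_inv _ _ _ L). apply Hp.
    - intros x Hx. rewrite Hh; auto. }
  assert (Hhm : forall w, In w I -> map (h w) D0 = w).
  { intros w Hw. destruct (Hh0 w Hw) as [_ [Hm _]]. rewrite <- Hm at 2.
    apply map_ext_in. auto. }
  assert (Hdis : forall w w' x x', In w I -> In w' I -> In x E -> In x' E ->
     h w x = h w' x' -> w = w' \/ In x D0).
  { intros w w' x x' Hw Hw' Hx Hx' E'. apply (perm_inj (pinv p) (h0 w x) (h0 w' x')) in E'.
    destruct (Hh0 w Hw) as [_ [_ H]]. eauto. }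
  assert (Hid : forall x, h D0 x = x) by (intros; apply pinvK).
  set (D := flat_map (fun w => map (h w) E) I).
  assert (HD : forall y, In y D <-> exists w x, In w I /\ In x E /\ y = h w x).
  { intros y. unfold D. rewrite in_flat_map. split.
    - intros [w [Hw Hy]]. apply in_map_iff in Hy. destruct Hy as [x [<- Hx]]. eauto.
    - intros [w [x [Hw [Hx ->]]]]. exists w. split; auto. now apply in_map. }
  exists D. split; [|split; [|split]].
  - intros y Hy. apply HD in Hy. destruct Hy as [w [x [Hw [Hx ->]]]].
    intros z Hz. apply HD.
    destruct (proj1 (in_map_iff (h w) E z)) as [u [Hu Hu']].
    { apply (down_map E (h w)) with (x := h w x); auto; [apply Hst; auto|now apply in_map]. }
    exists w, u. auto.
  - intros x Hx. apply HD. exists D0, x. rewrite Hid. auto.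
  - intros y Hy. apply HD in Hy. destruct Hy as [w [x [Hw [Hx ->]]]].
    exists (h w), x. destruct (Hst w Hw) as [Hg Hs].
    repeat split; auto. apply stable_rev; auto.
  - intros q Hq HqD.
    assert (HqI : forall w, In w I -> In (map q w) I).
    { intros w Hw. apply HI. exists (q ** h w). split.
      - destruct (Hst w Hw). split; [now apply (G_comp _ _ _ L)|].
        intros x Hx. change (In (q (h w x)) D0). auto.
      - rewrite <- (Hhm w Hw) at 2. rewrite map_map. reflexivity. }
    assert (Hpair : forall y, exists w x, In y D -> In w I /\ In x E /\ y = h w x).
    { intros y. destruct (classic (In y D)) as [Hy|Hy].
      - apply HD in Hy. destruct Hy as [w [x Hy]]. exists w, x. auto.
      - exists D0, y. tauto. }
    (* A choice of a copy containing [y]. It is ambiguous only over [D0], where [Hq0] makes the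
       choice irrelevant. *)
    set (wf := fun y => proj1_sig (constructive_indefinite_description _ (Hpair y))).
    assert (Hwf : forall y, exists x, In y D -> In (wf y) I /\ In x E /\ y = h (wf y) x).
    { intros y. unfold wf. destruct (constructive_indefinite_description _ (Hpair y)); auto. }
    (* The regular action: [q] carries the copy indexed by [w] to the one indexed by [map q w],
       keeping the coordinate in [E]. *)
    set (f := fun y => h (map q (wf y)) (pinv (h (wf y)) y)).
    assert (Hq0 : forall w x, In w I -> In x D0 -> h (map q w) x = q (h w x)).
    { intros w x Hw Hx. apply (proj1 (Hmap (h (map q w)) (q ** h w))); auto.
      rewrite (Hhm (map q w)) by auto. rewrite <- (Hhm w Hw) at 1. now rewrite map_map. }
    assert (Hf : forall w x, In w I -> In x E -> f (h w x) = h (map q w) x).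
    { intros w x Hw Hx. unfold f.
      assert (Hy : In (h w x) D) by (apply HD; eauto).
      destruct (Hwf (h w x)) as [x' Hx']. destruct (Hx' Hy) as [Hw' [Hx'E E']].
      set (w' := wf (h w x)) in *.
      rewrite E', pinvK.
      destruct (Hdis w w' x x' Hw Hw' Hx Hx'E E') as [<-|H0].
      - apply perm_inj in E'. now subst.
      - assert (H0' : In x' D0).
        { apply (stable_rev D0 (h w')); [apply Hst; auto|]. rewrite <- E'. now apply Hst. }
        rewrite !Hq0 by auto. now rewrite E'. }
    destruct (G_hom _ _ _ L D f) as [P [HP HPf]].
    + intros y Hy. apply HD in Hy. destruct Hy as [w [x [Hw [Hx ->]]]].
      intros z Hz. apply HD.
      destruct (proj1 (in_map_iff (h w) E z)) as [u [Hu Hu']].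
      { apply (down_map E (h w)) with (x := h w x); auto; [apply Hst; auto|now apply in_map]. }
      exists w, u. auto.
    + intros y y' Hy Hy' E'. apply HD in Hy, Hy'.
      destruct Hy as [w [x [Hw [Hx ->]]]], Hy' as [w' [x' [Hw' [Hx' ->]]]].
      rewrite !Hf in E' by auto.
      destruct (Hdis _ _ _ _ (HqI _ Hw) (HqI _ Hw') Hx Hx' E') as [Eq|H0].
      * rewrite Eq in E'. apply perm_inj in E'. subst x'.
        f_equal. f_equal.
        rewrite <- (Hhm w Hw), <- (Hhm w' Hw'), !map_map in Eq.
        rewrite <- (Hhm w Hw), <- (Hhm w' Hw'). apply Hmap. intros z Hz.
        apply (perm_inj q). now apply (proj1 (Hmap (q ** h w) (q ** h w')) Eq).
      * assert (H0' : In x' D0).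
        { apply (stable_rev D0 (h (map q w'))); [apply Hst; auto|].
          rewrite <- E'. apply Hst; auto. }
        rewrite !Hq0 in E' by auto. now apply perm_inj in E'.
    + intros y Hy. apply HD in Hy. destruct Hy as [w [x [Hw [Hx ->]]]].
      exists (h (map q w) ** pinv (h w)). split.
      * apply (G_comp _ _ _ L); [now apply Hst; auto|]. apply (G_inv _ _ _ L). now apply Hst.
      * intros z Hz.
        destruct (proj1 (in_map_iff (h w) E z)) as [u [<- Hu']].
        { apply (down_map E (h w)) with (x := h w x); auto; [apply Hst; auto|now apply in_map]. }
        rewrite Hf by auto.
        change (h (map q w) u = h (map q w) (pinv (h w) (h w u))). now rewrite pinvK.
    + exists P. split; auto. split.
      * intros x Hx. rewrite <- (HPf x).
        -- rewrite <- (Hid x) at 1. rewrite Hf by auto. rewrite Hq0 by auto. now rewrite Hid.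
        -- apply HD. exists D0, x. rewrite Hid; auto.
      * intros y Hy. rewrite <- HPf by auto. apply HD in Hy.
        destruct Hy as [w [x [Hw [Hx ->]]]]. rewrite Hf by auto. apply HD.
        exists (map q w), x. auto.
Qed.

(** Induction on the level bound. The induction hypothesis turns the points of level at most [k]
    into [D0]; the symmetries of [D0] are lifted to a larger [D'] whose new points all have level
    [k + 1]; after division by a lift, a partial map fixes [D0], and only blocks of new points
    remain to be permuted. *)
Lemma extension_property k : forall D, down D -> (forall x, In x D -> lev x <= k) ->
  exists D', down D' /\ incl D D' /\ (forall x, In x D' -> lev x <= k) /\
    forall g A, G g -> down A -> incl A D -> (forall x, In x A -> In (g x) D) ->
    exists g', G g' /\ agree A g' g /\ forall x, In x D' -> In (g' x) D'.
Proof.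
  induction k as [|k IH]; intros D HD Hk.
  { assert (HN : forall x, ~ In x D).
    { intros x Hx. specialize (Hk x Hx). pose proof (dn_refl _ _ _ L x) as Hr.
      unfold lev in Hk. destruct (dn x); simpl in *; [tauto|lia]. }
    exists D. repeat split; auto; [apply incl_refl|].
    intros g A Hg HA HAD HgA. exists g. repeat split; auto.
    intros x Hx. destruct (HN x Hx). }
  set (lo := sel (fun x => lev x <= k)).
  assert (Hlo : forall A, down A -> down (lo A)).
  { intros A HA x Hx y Hy. unfold lo in *. rewrite sel_In in *. split.
    - eapply HA; [apply Hx|auto].
    - pose proof (lev_le x y Hy). lia. }
  destruct (IH (lo D)) as [D0 [HD0 [HiD0 [HkD0 Hext]]]]; auto.
  { intros x Hx. apply sel_In in Hx. tauto. }
  destruct (stabiliser_lifts D0 (D ++ D0)) as [D' [HD' [Hi' [Htr HP]]]]; auto.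
  { now apply down_app. }
  { intros x Hx. apply in_app_iff; auto. }
  assert (Htop : forall x, In x D' -> ~ In x D0 -> lev x = S k).
  { intros y Hy Hy0. destruct (Htr y Hy) as [g [x [Hg [Hst [Hx ->]]]]].
    rewrite lev_G by auto. rewrite in_app_iff in Hx.
    assert (Hx0 : ~ In x D0) by (rewrite Hst; auto).
    destruct Hx as [Hx|Hx]; [|tauto].
    destruct (le_lt_dec (lev x) k) as [Hle|Hlt]; [|specialize (Hk x Hx); lia].
    exfalso. apply Hx0, HiD0. unfold lo. apply sel_In. auto. }
  assert (H0D' : incl D0 D').
  { intros x Hx. apply Hi', in_app_iff; auto. }
  exists D'. split; auto. split.
  { intros x Hx. apply Hi', in_app_iff; auto. }
  split.
  { intros x Hx. destruct (classic (In x D0)) as [H|H].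
    - specialize (HkD0 x H). lia.
    - rewrite Htop; auto. }
  intros g A Hg HA HAD HgA.
  (* [q] completes the low part of [g] on [D0], [g1] combines [g] on [A] with [q] on [D0], and [P]
     lifts [q] to [D']. Hence [pinv P ** g1] fixes [D0] pointwise. *)
  destruct (Hext g (lo A)) as [q [Hq [Eq HqD]]]; auto.
  { intros x Hx. unfold lo in *. rewrite sel_In in *. destruct Hx; auto. }
  { intros x Hx. unfold lo in *. rewrite sel_In in *. rewrite lev_G by auto. destruct Hx; auto. }
  destruct (glue A D0 g q) as [g1 [Hg1 [E1 E2]]]; auto.
  { intros x Hx Hx0. symmetry. apply Eq. apply sel_In. auto. }
  { intros x y Hx Hy E. assert (Hl : lev x <= k).
    { rewrite <- (lev_G g x), E, lev_G by auto. auto. }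
    apply (perm_inj q). rewrite <- E. apply Eq. apply sel_In; auto. }
  destruct (HP q Hq HqD) as [P [HGP [EP HPD]]].
  destruct (flat_extend D' D0) with (A := A ++ D0) (r := pinv P ** g1) as [R [HR [ER HRD]]]; auto.
  - intros x y Hx Hx0 Hy Hy0. apply lev_eq; auto.
    rewrite (Htop x), (Htop y); auto. eapply HD'; eauto.
  - now apply down_app.
  - intros x Hx. apply in_app_iff; auto.
  - apply incl_app; auto. intros x Hx. apply Hi', in_app_iff; auto.
  - apply (G_comp _ _ _ L); auto. now apply (G_inv _ _ _ L).
  - intros x Hx. simpl. rewrite E2 by auto. apply pinv_eq. auto.
  - intros x Hx. apply (stable_rev D' P); auto. simpl. change (In (P (pinv P (g1 x))) D').
    rewrite pinvVK.
    rewrite in_app_iff in Hx. destruct Hx as [Hx|Hx].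
    + rewrite E1 by auto. apply Hi', in_app_iff; auto.
    + rewrite E2 by auto. auto.
  - exists (P ** R). split; [now apply (G_comp _ _ _ L)|]. split.
    + intros x Hx. simpl. rewrite ER by (apply in_app_iff; auto). simpl.
      rewrite <- E1 by auto. apply (pinvVK P).
    + intros x Hx. simpl. auto.
Qed.

(** Extension property for partial automorphisms: one [D'] serves all partial maps of [D] at
    once. *)
Lemma eppa D : down D -> exists D', down D' /\ incl D D' /\
    forall g A, G g -> down A -> incl A D -> (forall x, In x A -> In (g x) D) ->
    exists g', G g' /\ agree A g' g /\ forall x, In x D' -> In (g' x) D'.
Proof.
  intros HD.
  assert (Hk : exists k, forall x, In x D -> lev x <= k).
  { clear HD. induction D as [|a D [k IH]]; [exists 0; simpl; tauto|].
    exists (max k (lev a)). intros x [<-|Hx]; [lia|]. specialize (IH x Hx). lia. }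
  destruct Hk as [k Hk]. destruct (extension_property k D HD Hk) as [D' H].
  exists D'. intuition.
Qed.

End Layered.

(** * Generic tuples *)

Fixpoint encode (l : list nat) : nat :=
  match l with [] => 0 | x :: l => S (Cantor.to_nat (x, encode l)) end.

Lemma encode_inj l l' : encode l = encode l' -> l = l'.
Proof.
  revert l'. induction l as [|a l IH]; intros [|b l'] E; auto; try discriminate.
  unfold encode in E; fold encode in E. apply eq_add_S in E. apply Cantor.to_nat_inj in E. injection E as -> E.
  f_equal; auto.
Qed.

Lemma map_inj {A B} (f : A -> B) l l' :
  (forall x y, f x = f y -> x = y) -> map f l = map f l' -> l = l'.
Proof.
  intros Hf. revert l'. induction l as [|a l IH]; intros [|b l'] E; try discriminate; auto.
  injection E as E1 E2. f_equal; auto.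
Qed.

Lemma dependent_choice_nat {A} (R : nat -> A -> A -> Prop) (a0 : A) :
  (forall n a, exists b, R n a b) -> exists f, f 0 = a0 /\ forall n, R n (f n) (f (S n)).
Proof.
  intros H.
  set (g := fun n a => proj1_sig (constructive_indefinite_description _ (H n a))).
  exists (fix f n := match n with 0 => a0 | S n => g n (f n) end). split; auto.
  intros n. unfold g at 2. simpl. apply proj2_sig.
Qed.

Lemma choice_fun {A B} (R : A -> B -> Prop) :
  (forall a, exists b, R a b) -> exists f, forall a, R a (f a).
Proof.
  intros H. exists (fun a => proj1_sig (constructive_indefinite_description _ (H a))).
  intros a. apply proj2_sig.
Qed.

Lemma first_difference (s t : nat -> bool) : s <> t ->
  exists n, s n <> t n /\ forall i, i < n -> s i = t i.
Proof.
  intros H.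
  assert (Hn : exists n, s n <> t n).
  { apply NNPP. intros Hn. apply H. apply functional_extensionality. intros n.
    apply NNPP. intros E. apply Hn. eauto. }
  destruct Hn as [n Hn]. induction n as [n IH] using lt_wf_ind.
  destruct (classic (exists i, i < n /\ s i <> t i)) as [[i [Hi E]]|E]; eauto.
  exists n. split; auto. intros i Hi. apply NNPP. intros E'. apply E. eauto.
Qed.

Fixpoint bools (n : nat) : list (list bool) :=
  match n with
  | 0 => [[]]
  | S n => flat_map (fun s => [true :: s; false :: s]) (bools n)
  end.

(** The latest bit comes first, so a child is formed by [cons] and its parent recovered by [tl]. *)
Fixpoint path (s : nat -> bool) (n : nat) : list bool :=
  match n with 0 => [] | S n => s n :: path s n end.

Lemma path_bools s n : In (path s n) (bools n).
Proof.
  induction n; simpl; auto. apply in_flat_map. exists (path s n). split; auto.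
  destruct (s n); simpl; auto.
Qed.

Lemma path_neq s t i n : s i <> t i -> i < n -> path s n <> path t n.
Proof.
  intros H. induction n; [lia|]. intros Hi E. simpl in E. injection E as E1 E2.
  destruct (Nat.eq_dec i n) as [->|]; [congruence|]. apply IHn; auto. lia.
Qed.

Section Generic.

Context {T : Type} {c : T -> nat} {dn : T -> list T} {G : perm T -> Prop}.
Hypothesis L : layered c dn G.

(** The approximations stabilise on sets exhausting the space, which defines an injection; the last
    hypothesis makes it onto. It agrees with some [k n] on any finite set, so [G_closed] applies. *)
Lemma limit (k : nat -> perm T) (D : nat -> list T) :
  (forall n, G (k n)) -> (forall n, incl (D n) (D (S n))) ->
  (forall n, agree (D n) (k n) (k (S n))) -> (forall x, exists n, In x (D n)) ->
  (forall y, exists n x, In x (D n) /\ k n x = y) ->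
  exists h, G h /\ forall n, agree (D n) h (k n).
Proof.
  intros HG Hinc Hag Hcov Hsur.
  assert (Hinc' : forall n m, n <= m -> incl (D n) (D m)).
  { intros n m H. induction H; [apply incl_refl|]. eapply incl_tran; eauto. }
  assert (Hag' : forall n m, n <= m -> agree (D n) (k n) (k m)).
  { intros n m H. induction H as [|m H IH]; intros x Hx; auto.
    rewrite IH by auto. apply Hag. eapply Hinc'; eauto. }
  destruct (choice_fun _ Hcov) as [N HN].
  set (f := fun x => k (N x) x).
  assert (Hf : forall n x, In x (D n) -> f x = k n x).
  { intros n x Hx. unfold f.
    transitivity (k (max n (N x)) x); [|symmetry]; (apply Hag'; [apply Nat.le_max_r || apply Nat.le_max_l|auto]). }
  assert (Hsf : forall y, exists x, f x = y).
  { intros y. destruct (Hsur y) as [n [x [Hx E]]]. exists x. rewrite (Hf n); auto. }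
  destruct (choice_fun _ Hsf) as [f' Hf'].
  assert (Hinj : forall x y, f x = f y -> x = y).
  { intros x y E. set (n := max (N x) (N y)).
    rewrite (Hf n x), (Hf n y) in E; [now apply perm_inj in E| |];
      (eapply Hinc'; [|apply HN]; unfold n; lia). }
  exists (Perm f f' (fun x => Hinj _ _ (Hf' (f x))) Hf'). split; [|intros n x; apply Hf].
  apply (G_closed _ _ _ L). intros E.
  assert (Hn : exists n, incl E (D n)).
  { induction E as [|a E [n IH]]; [exists 0; intros x []|].
    exists (max n (N a)). intros x [<-|Hx].
    - eapply Hinc'; [|apply HN]. lia.
    - eapply Hinc'; [|apply IH; auto]. lia. }
  destruct Hn as [n Hn]. exists (k n). split; auto. intros x Hx. simpl. auto.
Qed.

(** A list rather than a point, as [c] need not be onto. The lists [pts n] together enumerate the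
    space. *)
Lemma pts_exists n : exists l, forall x, c x = n -> In x l.
Proof.
  destruct (classic (exists x, c x = n)) as [[x Hx]|H].
  - exists [x]. intros y Hy. left. apply (code_inj _ _ _ L). congruence.
  - exists []. intros x Hx. apply H. eauto.
Qed.

Definition pts n := proj1_sig (constructive_indefinite_description _ (pts_exists n)).

Lemma pts_In x : In x (pts (c x)).
Proof. unfold pts. destruct (constructive_indefinite_description _ _); simpl; auto. Qed.

(** * Baire category in pointwise stabilisers *)

Definition pstab F g := G g /\ fixes F g.

Lemma pstab_id F : pstab F pid.
Proof. split; [apply (G_id _ _ _ L)|intros x _; reflexivity]. Qed.

Lemma pstab_comp F g h : pstab F g -> pstab F h -> pstab F (g ** h).
Proof.
  intros [Hg Fg] [Hh Fh]. split; [now apply (G_comp _ _ _ L)|].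
  intros x Hx. simpl. rewrite Fh; auto.
Qed.

Lemma pstab_inv F g : pstab F g -> pstab F (pinv g).
Proof.
  intros [Hg Fg]. split; [now apply (G_inv _ _ _ L)|].
  intros x Hx. apply pinv_eq. auto.
Qed.

(* O contains a dense open subset of the pointwise stabiliser of F. *)
Definition dopen F (O : perm T -> Prop) := forall g E, pstab F g ->
  exists u E', pstab F u /\ agree E g u /\ forall u', pstab F u' -> agree E' u u' -> O u'.

Lemma dopen_and F O1 O2 : dopen F O1 -> dopen F O2 -> dopen F (fun u => O1 u /\ O2 u).
Proof.
  intros H1 H2 g E Hg.
  destruct (H1 g E Hg) as [u1 [E1 [Hu1 [A1 R1]]]].
  destruct (H2 u1 (E ++ E1) Hu1) as [u2 [E2 [Hu2 [A2 R2]]]].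
  exists u2, (E1 ++ E2). split; auto. split.
  - intros x Hx. rewrite A1, A2; auto. apply in_app_iff; auto.
  - intros u' Hu' A'. split.
    + apply R1; auto. intros x Hx. rewrite A2, A'; auto; apply in_app_iff; auto.
    + apply R2; auto. intros x Hx. apply A'. apply in_app_iff; auto.
Qed.

(** The map taking [u] to [pinv u ** v] is a homeomorphism of the stabiliser. An approximation [z']
    of [pinv g ** v] in the interior of [O] gives the witness [v ** pinv z']. *)
Lemma dopen_twist F O v : dopen F O -> pstab F v -> dopen F (fun u => O (pinv u ** v)).
Proof.
  intros HO Hv g E Hg. set (z := pinv g ** v).
  assert (Hz : pstab F z) by (apply pstab_comp; auto; now apply pstab_inv).
  destruct (HO z (map (pinv z) E) Hz) as [z' [E' [Hz' [A' R']]]].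
  exists (v ** pinv z'), (map z' E'). split; [|split].
  - apply pstab_comp; auto. now apply pstab_inv.
  - intros x Hx. change (g x = v (pinv z' x)).
    rewrite (pinv_eq z' (pinv z x) x).
    + apply (perm_inj (pinv g)). change (pinv g (g x) = z (pinv z x)).
      now rewrite pinvK, pinvVK.
    + rewrite <- A' by now apply in_map. apply pinvVK.
  - intros u' Hu' Au. apply R'.
    + apply pstab_comp; auto. now apply pstab_inv.
    + intros y Hy. symmetry. apply (pinv_eq u'). rewrite <- Au by now apply in_map.
      change (v (pinv z' (z' y)) = v y). now rewrite pinvK.
Qed.

(** The requirements are met one after the other. For [(s, t, i)] only the entry at [t] changes, to
    [ga s ** u] with [u] close to the old quotient and inside the open part of [O i]. Freezing all
    entries on [E] and [map u E] preserves this, since those values determine the quotient on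
    [E]. *)
Lemma meet_requirements F (O : nat -> perm T -> Prop) : (forall i, dopen F (O i)) ->
  forall (Q : list (list bool * list bool * nat)) (ga : list bool -> perm T) D,
  (forall s, pstab F (ga s)) -> (forall s t i, In (s, t, i) Q -> s <> t) ->
  exists ga' D', (forall s, pstab F (ga' s)) /\ incl D D' /\ (forall s, agree D (ga s) (ga' s)) /\
    forall s t i, In (s, t, i) Q -> forall a b, pstab F a -> pstab F b ->
      agree D' (ga' s) a -> agree D' (ga' t) b -> O i (pinv a ** b).
Proof.
  intros HO. induction Q as [|[[s t] i] Q IH]; intros ga D Hga HQ.
  { exists ga, D. repeat split; auto; try apply Hga; [apply incl_refl|]. intros s t i []. }
  assert (Hst : s <> t) by (apply (HQ s t i); simpl; auto).
  destruct (HO i (pinv (ga s) ** ga t) D) as [u [E [Hu [Au Ru]]]].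
  { apply pstab_comp; auto. now apply pstab_inv. }
  set (ga1 := fun r => if eq_dec_c r t then ga s ** u else ga r).
  assert (Hga1 : forall r, pstab F (ga1 r)).
  { intros r. unfold ga1. destruct (eq_dec_c r t); auto. now apply pstab_comp. }
  destruct (IH ga1 (D ++ E ++ map u E)) as [ga' [D' [H1 [H2 [H3 H4]]]]]; auto.
  { intros s' t' i' H. apply (HQ s' t' i'). simpl; auto. }
  exists ga', D'. split; auto. split; [|split].
  - intros x Hx. apply H2, in_app_iff; auto.
  - intros r x Hx. rewrite <- H3 by (apply in_app_iff; auto).
    unfold ga1. destruct (eq_dec_c r t) as [->|]; auto.
    change (ga t x = ga s (u x)). rewrite <- Au by auto. change (ga t x = ga s (pinv (ga s) (ga t x))).
    now rewrite pinvVK.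
  - intros s' t' i' [Heq|Hin]; [|now apply H4]. injection Heq as <- <- <-.
    intros a b Ha Hb Aa Ab. apply Ru.
    + apply pstab_comp; auto. now apply pstab_inv.
    + intros x Hx. symmetry. apply (pinv_eq a).
      rewrite <- Aa, <- H3.
      * rewrite <- Ab, <- H3.
        -- unfold ga1. destruct (eq_dec_c s t); [contradiction|].
           destruct (eq_dec_c t t); [reflexivity|contradiction].
        -- rewrite !in_app_iff; auto.
        -- apply H2. rewrite !in_app_iff; auto.
      * rewrite !in_app_iff. right; right. now apply in_map.
      * apply H2. rewrite !in_app_iff. right; right. now apply in_map.
Qed.

(** A perfect set of generic quotients in the manner of Mycielski: approximations indexed by the
    binary tree are refined so that distinct nodes of level [n + 1] have quotients forced into the
    sets of index at most [n]. Limits are taken along branches. *)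
Lemma mycielski F (O : nat -> perm T -> Prop) : (forall i, dopen F (O i)) ->
  exists phi : (nat -> bool) -> perm T, (forall s, pstab F (phi s)) /\
    forall s t, s <> t -> forall i, O i (pinv (phi s) ** phi t).
Proof.
  intros HO.
  set (St := {st : (list bool -> perm T) * list T | forall s, pstab F (fst st s)}).
  set (ga := fun st : St => fst (proj1_sig st)).
  set (dm := fun st : St => snd (proj1_sig st)).
  (* Each stage absorbs the point coded [n] and its preimages under the approximations of the level,
     so limits are defined everywhere and onto. The initial domain [F] makes them fix [F]. *)
  set (R := fun n (st st' : St) => incl (dm st) (dm st') /\
    (forall b s, agree (dm st) (ga st s) (ga st' (b :: s))) /\
    incl (pts n) (dm st') /\
    (forall s y, In s (bools (S n)) -> In y (pts n) -> In (pinv (ga st' s) y) (dm st')) /\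
    forall s t i, In s (bools (S n)) -> In t (bools (S n)) -> s <> t -> i <= n ->
      forall a b, pstab F a -> pstab F b -> agree (dm st') (ga st' s) a -> agree (dm st') (ga st' t) b ->
      O i (pinv a ** b)).
  destruct (dependent_choice_nat R) with (a0 := exist (fun st => forall s, pstab F (fst st s))
     ((fun _ : list bool => @pid T), F) (fun s => pstab_id F) : St) as [f [Hf0 Hf]].
  { intros n [[g D] Hg]. simpl in Hg.
    set (Q := sel (fun q => fst (fst q) <> snd (fst q))
      (list_prod (list_prod (bools (S n)) (bools (S n))) (seq 0 (S n)))).
    destruct (meet_requirements F O HO Q (fun l => g (tl l)) D) as [g' [D' [H1 [H2 [H3 H4]]]]]; auto.
    { intros s t i H. unfold Q in H. rewrite sel_In in H. apply H. }
    set (D2 := D' ++ pts n ++ flat_map (fun s => map (pinv (g' s)) (pts n)) (bools (S n))).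
    exists (exist (fun st => forall s, pstab F (fst st s)) (g', D2) H1).
    assert (HD2 : incl D' D2) by (intros x Hx; apply in_app_iff; auto).
    unfold R, ga, dm; cbn [proj1_sig fst snd]. split; [|split; [|split; [|split]]].
    - eapply incl_tran; eauto.
    - intros b s. apply (H3 (b :: s)).
    - intros x Hx. unfold D2. rewrite !in_app_iff; auto.
    - intros s y Hs Hy. unfold D2. rewrite !in_app_iff. right; right.
      apply in_flat_map. exists s. split; auto. now apply in_map.
    - intros s t i Hs Ht Hst Hi a b Ha Hb Aa Ab.
      apply (H4 s t i); auto.
      + unfold Q. apply sel_In. split; auto.
        apply in_prod; [now apply in_prod|]. apply in_seq. lia.
      + eapply agree_sub; eauto.
      + eapply agree_sub; eauto. }
  assert (Hlim : forall s : nat -> bool, exists h, pstab F h /\ forall n, agree (dm (f n)) h (ga (f n) (path s n))).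
  { intros s. destruct (limit (fun n => ga (f n) (path s n)) (fun n => dm (f n))) as [h [Hh Ah]].
    - intros n. apply (proj2_sig (f n) (path s n)).
    - intros n. apply Hf.
    - intros n. apply Hf.
    - intros x. exists (S (c x)). apply (Hf (c x)). apply pts_In.
    - intros y. exists (S (c y)), (pinv (ga (f (S (c y))) (path s (S (c y)))) y). split.
      + apply (Hf (c y)); [apply path_bools|apply pts_In].
      + apply pinvVK.
    - exists h. split; auto. split; auto. intros x Hx.
      rewrite (Ah 0); rewrite Hf0; [reflexivity|exact Hx]. }
  destruct (choice_fun _ Hlim) as [phi Hphi]. exists phi.
  split; [intros s; apply Hphi|].
  intros s t Hst i. destruct (first_difference s t Hst) as [j [Hj _]].
  (* At level [n + 1] the two paths already differ, since [j <= n], and the set of index [i <= n]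
     has been treated. *)
  set (n := max i j).
  destruct (Hf n) as [_ [_ [_ [_ H]]]].
  apply (H (path s (S n)) (path t (S n))); try apply path_bools; try apply Hphi.
  - apply path_neq with j; auto. unfold n. lia.
  - unfold n; lia.
  - intros x Hx. symmetry. now apply Hphi.
  - intros x Hx. symmetry. now apply Hphi.
Qed.

Definition stable n (w : nat -> perm T) D := forall i x, i < n -> In x D -> In (w i x) D.

(* A generic tuple w_0, ..., w_{n-1}: an ultrahomogeneous locally finite action
   of the free group of rank n by elements of G. *)
Record generic n (w : nat -> perm T) : Prop := {
  gen_G : forall i, i < n -> G (w i);
  gen_lf : forall x, exists D, down (dn:=dn) D /\ In x D /\ stable n w D;
  gen_ext : forall D D' om, down (dn:=dn) D -> down (dn:=dn) D' -> incl D D' -> stable n w D ->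
    (forall i, i < n -> G (om i)) -> stable n om D' ->
    (forall i, i < n -> agree D (om i) (w i)) ->
    exists k, pstab D k /\ forall i x, i < n -> In x D' -> w i (k x) = k (om i x) }.

Lemma gen_lf_list n w l : generic n w ->
  exists D, down (dn:=dn) D /\ incl l D /\ stable n w D.
Proof.
  intros Hw. induction l as [|a l [D [H1 [H2 H3]]]].
  - exists []. repeat split; intros x; simpl; tauto.
  - destruct (gen_lf _ _ Hw a) as [E [E1 [E2 E3]]]. exists (E ++ D).
    split; [now apply down_app|]. split.
    + intros x [<-|Hx]; apply in_app_iff; auto.
    + intros i x Hi Hx. rewrite in_app_iff in *. destruct Hx; [left|right]; auto.
Qed.

Lemma generic0 w : generic 0 w.
Proof.
  split.
  - lia.
  - intros x. exists (dn x). split; [apply (down_dn L)|]. split; [apply (dn_refl _ _ _ L)|].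
    intros i; lia.
  - intros. exists pid. split; [apply pstab_id|]. lia.
Qed.

(** * Conjugacy of generic tuples *)

Definition intertwines n (w w' : nat -> perm T) D (k : perm T) :=
  forall i x, i < n -> In x D -> k (w i x) = w' i (k x).

(** Conjugating [w] by [k] on a larger stable set [D'] gives an extension problem for [w'] over
    [map k D]; its solution [j] corrects [k] to [j ** k] without changing it on [D]. *)
Lemma conj_forth n w w' F D k l : generic n w -> generic n w' ->
  pstab F k -> incl F D -> down (dn:=dn) D -> stable n w D -> intertwines n w w' D k ->
  exists k' D', pstab F k' /\ agree D k k' /\ incl D D' /\ incl l D' /\
    down (dn:=dn) D' /\ stable n w D' /\ intertwines n w w' D' k'.
Proof.
  intros Hw Hw' [Hk Fk] HF HD Hs Hi.
  destruct (gen_lf_list n w (D ++ l) Hw) as [D' [HD' [Hl Hs']]].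
  destruct (gen_ext _ _ Hw' (map k D) (map k D') (fun i => k ** w i ** pinv k)) as [j [[Hj Fj] Hji]].
  - now apply (down_map L).
  - now apply (down_map L).
  - apply incl_map. intros x Hx. apply Hl, in_app_iff; auto.
  - intros i y Hin Hy. apply in_map_iff in Hy. destruct Hy as [x [<- Hx]].
    rewrite <- Hi by auto. apply in_map; auto.
  - intros i Hin. apply (G_comp _ _ _ L); [apply (G_comp _ _ _ L)|]; auto.
    + now apply Hw.
    + now apply (G_inv _ _ _ L).
  - intros i y Hin Hy. apply in_map_iff in Hy. destruct Hy as [x [<- Hx]].
    change (In (k (w i (pinv k (k x)))) (map k D')). rewrite pinvK. apply in_map; auto.
  - intros i Hin y Hy. apply in_map_iff in Hy. destruct Hy as [x [<- Hx]].
    change (k (w i (pinv k (k x))) = w' i (k x)). rewrite pinvK. auto.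
  - exists (j ** k), D'. split; [split|split; [|split; [|split; [|split; [|split]]]]]; auto.
    + now apply (G_comp _ _ _ L).
    + intros x Hx. change (j (k x) = x). rewrite Fj; auto. apply in_map; auto.
    + intros x Hx. change (k x = j (k x)). rewrite Fj; auto. now apply in_map.
    + intros x Hx. apply Hl, in_app_iff; auto.
    + intros x Hx. apply Hl, in_app_iff; auto.
    + intros i x Hin Hx. change (j (k (w i x)) = w' i (j (k x))).
      rewrite Hji by (auto; now apply in_map).
      change (j (k (w i x)) = j (k (w i (pinv k (k x))))). now rewrite pinvK.
Qed.

(** The forth step for [pinv k], with the two tuples exchanged. *)
Lemma conj_back n w w' F D k l : generic n w -> generic n w' ->
  pstab F k -> incl F D -> down (dn:=dn) D -> stable n w D -> intertwines n w w' D k ->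
  exists k' D', pstab F k' /\ agree D k k' /\ incl D D' /\ (forall y, In y l -> In (pinv k' y) D') /\
    down (dn:=dn) D' /\ stable n w D' /\ intertwines n w w' D' k'.
Proof.
  intros Hw Hw' Hk HF HD Hs Hi.
  destruct (conj_forth n w' w F (map k D) (pinv k) l) as [j [E [Hj [Aj [HE [Hl [HEd [Es Ei]]]]]]]]; auto.
  - now apply pstab_inv.
  - intros x Hx. rewrite <- (proj2 Hk x Hx). apply in_map; auto.
  - apply (down_map L); auto. apply Hk.
  - intros i y Hin Hy. apply in_map_iff in Hy. destruct Hy as [x [<- Hx]].
    rewrite <- Hi by auto. apply in_map; auto.
  - intros i y Hin Hy. apply in_map_iff in Hy. destruct Hy as [x [<- Hx]].
    apply pinv_eq. rewrite pinvK. auto.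
  - assert (Ajk : forall x, In x D -> j (k x) = x).
    { intros x Hx. rewrite <- Aj by now apply in_map. apply pinvK. }
    exists (pinv j), (map j E). split; [now apply pstab_inv|].
    split; [|split; [|split; [|split; [|split]]]].
    + intros x Hx. symmetry. apply pinv_eq. auto.
    + intros x Hx. rewrite <- (Ajk x Hx). apply in_map. apply HE. now apply in_map.
    + intros y Hy. change (In (j y) (map j E)). apply in_map; auto.
    + apply (down_map L); auto. apply Hj.
    + intros i y Hin Hy. apply in_map_iff in Hy. destruct Hy as [x [<- Hx]].
      rewrite <- Ei by auto. apply in_map; auto.
    + intros i y Hin Hy. apply in_map_iff in Hy. destruct Hy as [x [<- Hx]].
      rewrite <- Ei by auto. now rewrite !pinvK.
Qed.

(** Back-and-forth over finite [w]-stable sets, starting from the identity on [F]. *)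
Lemma generic_conj n w w' F : generic n w -> generic n w' -> down (dn:=dn) F -> stable n w F ->
  (forall i, i < n -> agree F (w i) (w' i)) ->
  exists k, pstab F k /\ forall i x, i < n -> k (w i x) = w' i (k x).
Proof.
  intros Hw Hw' HF Hs Hag.
  set (St := {st : perm T * list T | pstab F (fst st) /\ incl F (snd st) /\ down (dn:=dn) (snd st) /\
    stable n w (snd st) /\ intertwines n w w' (snd st) (fst st)}).
  set (kk := fun st : St => fst (proj1_sig st)).
  set (dm := fun st : St => snd (proj1_sig st)).
  set (R := fun j (st st' : St) => incl (dm st) (dm st') /\ agree (dm st) (kk st) (kk st') /\
    incl (pts j) (dm st') /\ forall y, In y (pts j) -> In (pinv (kk st') y) (dm st')).
  assert (H0 : pstab F (@pid T) /\ incl F F /\ down (dn:=dn) F /\ stable n w F /\ intertwines n w w' F pid).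
  { split; [apply pstab_id|]. split; [apply incl_refl|]. split; auto. split; auto.
    intros i x Hi Hx. simpl. now apply Hag. }
  destruct (dependent_choice_nat R) with (a0 := exist _ (pid, F) H0 : St) as [f [Hf0 Hf]].
  { intros j [[k D] [Hk [HFD [HD [HDs HDi]]]]]. simpl in *.
    destruct (conj_forth n w w' F D k (pts j)) as [k1 [D1 [Hk1 [A1 [I1 [P1 [D1d [D1s D1i]]]]]]]]; auto.
    destruct (conj_back n w w' F D1 k1 (pts j)) as [k2 [D2 [Hk2 [A2 [I2 [P2 [D2d [D2s D2i]]]]]]]]; auto.
    { eapply incl_tran; eauto. }
    assert (H2 : pstab F k2 /\ incl F D2 /\ down (dn:=dn) D2 /\ stable n w D2 /\ intertwines n w w' D2 k2).
    { repeat split; auto; try apply Hk2. eapply incl_tran; [eauto|]. eapply incl_tran; eauto. }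
    exists (exist _ (k2, D2) H2). unfold R, kk, dm; cbn [proj1_sig fst snd].
    split; [eapply incl_tran; eauto|]. split; [|split].
    - intros x Hx. rewrite A1, A2; auto.
    - eapply incl_tran; eauto.
    - auto. }
  destruct (limit (fun j => kk (f j)) (fun j => dm (f j))) as [h [Hh Ah]].
  - intros j. apply (proj2_sig (f j)).
  - intros j. apply Hf.
  - intros j. apply Hf.
  - intros x. exists (S (c x)). apply (Hf (c x)). apply pts_In.
  - intros y. exists (S (c y)), (pinv (kk (f (S (c y)))) y). split.
    + apply (Hf (c y)). apply pts_In.
    + apply pinvVK.
  - exists h. split; [split; auto|].
    + intros x Hx. rewrite (Ah 0); rewrite Hf0; [reflexivity|exact Hx].
    + intros i x Hi.
      set (st := f (S (c x))).
      assert (Hx : In x (dm st)) by (apply (Hf (c x)); apply pts_In).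
      destruct (proj2_sig st) as [_ [_ [_ [Hst Hin]]]].
      rewrite (Ah (S (c x)) (w i x)) by now apply Hst.
      rewrite (Ah (S (c x)) x) by auto. now apply Hin.
Qed.

(** * One-step extensions of a generic tuple *)

Definition extend n (w : nat -> perm T) (u : perm T) : nat -> perm T :=
  fun i => if Nat.eqb i n then u else w i.

Lemma extend_last n w u : extend n w u n = u.
Proof. unfold extend. now rewrite Nat.eqb_refl. Qed.

Lemma extend_old n w u i : i < n -> extend n w u i = w i.
Proof.
  intros H. unfold extend. destruct (Nat.eqb_spec i n); auto. lia.
Qed.

Lemma forall_lt_S n (P : nat -> Prop) : (forall i, i < n -> P i) -> P n -> forall i, i < S n -> P i.
Proof. intros H Hn i Hi. destruct (Nat.eq_dec i n) as [->|]; auto. apply H. lia. Qed.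

(** By [eppa] both [g] on [A] and the entries of [w] on a stable [B] are completed to permutations
    of one finite [D]. Genericity of [w] realises [D] over [B] through some [k], and the completed
    [g] conjugated by [k] is the witness. *)
Lemma locally_finite_dense n w F g E l : generic n w -> down (dn:=dn) F -> pstab F g ->
  exists u E1, pstab F u /\ agree E g u /\ down (dn:=dn) E1 /\ incl F E1 /\ incl E E1 /\ incl l E1 /\
    stable n w E1 /\ forall x, In x E1 -> In (u x) E1.
Proof.
  intros Hw HF [Hg Fg].
  set (A := F ++ dcl (dn:=dn) E).
  assert (HA : down (dn:=dn) A) by (apply down_app; auto; apply (dcl_down L)).
  destruct (gen_lf_list n w (A ++ map g A ++ l) Hw) as [B [HB [HlB HsB]]].
  destruct (eppa L B HB) as [D [HD [HBD Hext]]].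
  assert (Hom : forall i, exists om, i < n ->
     G om /\ agree B om (w i) /\ forall x, In x D -> In (om x) D).
  { intros i. destruct (le_lt_dec n i) as [H|H]; [exists pid; lia|].
    destruct (Hext (w i) B) as [om Hom]; auto.
    - now apply Hw.
    - apply incl_refl.
    - exists om. auto. }
  destruct (choice_fun _ Hom) as [om Hom'].
  destruct (Hext g A) as [ta [Gta [Ata Dta]]]; auto.
  { intros x Hx. apply HlB, in_app_iff; auto. }
  { intros x Hx. apply HlB. rewrite !in_app_iff. right; left. now apply in_map. }
  destruct (gen_ext _ _ Hw B D om) as [k [[Hk Fk] Hki]]; auto.
  { intros i Hi. now apply Hom'. }
  { intros i x Hi Hx. now apply Hom'. }
  { intros i Hi. now apply Hom'. }
  set (u := k ** ta ** pinv k).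
  assert (HAB : incl A B) by (intros x Hx; apply HlB, in_app_iff; auto).
  assert (HuA : forall x, In x A -> u x = g x).
  { intros x Hx. change (k (ta (pinv k x)) = g x).
    rewrite (pinv_eq k x x) by auto. rewrite Ata by auto. apply Fk.
    apply HlB. rewrite !in_app_iff. right; left. now apply in_map. }
  exists u, (map k D). split; [split|].
  { apply (G_comp _ _ _ L); [now apply (G_comp _ _ _ L)|now apply (G_inv _ _ _ L)]. }
  { intros x Hx. rewrite HuA; [auto|]. apply in_app_iff; auto. }
  split.
  { intros x Hx. symmetry. apply HuA. apply in_app_iff. right. now apply (dcl_incl L). }
  assert (HBk : incl B (map k D)).
  { intros x Hx. rewrite <- (Fk x Hx). apply in_map. auto. }
  split; [now apply (down_map L)|].
  split; [|split; [|split; [|split]]].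
  - intros x Hx. apply HBk, HAB, in_app_iff; auto.
  - intros x Hx. apply HBk, HAB, in_app_iff. right. now apply (dcl_incl L).
  - intros x Hx. apply HBk, HlB. rewrite !in_app_iff; auto.
  - intros i y Hi Hy. apply in_map_iff in Hy. destruct Hy as [x [<- Hx]].
    rewrite Hki by auto. apply in_map. now apply Hom'.
  - intros y Hy. apply in_map_iff in Hy. destruct Hy as [x [<- Hx]].
    change (In (k (ta (pinv k (k x)))) (map k D)). rewrite pinvK. apply in_map; auto.
Qed.

(* Amalgamating an extension problem for (w, u) freely with a finite (w, u)-stable
   set and realising it through the genericity of w alone. *)
Lemma solve_problem n w u D D' om E1 : generic n w -> G u -> down (dn:=dn) E1 -> stable n w E1 ->
  (forall x, In x E1 -> In (u x) E1) ->
  incl D' E1 -> down (dn:=dn) D -> down (dn:=dn) D' -> incl D D' ->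
  stable (S n) (extend n w u) D -> (forall i, i < S n -> G (om i)) -> stable (S n) om D' ->
  (forall i, i < S n -> agree D (om i) (extend n w u i)) ->
  exists u' k, G u' /\ agree E1 u u' /\ pstab D k /\
    forall i x, i < S n -> In x D' -> extend n w u' i (k x) = k (om i x).
Proof.
  intros Hw Hu HE1 HsE HuE HDE HD HD' HDD Hst Hom Homs Hag.
  (* After moving by [l], the problem meets [E1] only inside [D]. *)
  destruct (G_move _ _ _ L D (E1 ++ D')) as [l [Hl [Fl Ml]]]; auto.
  assert (Hlm : forall x, In x D' -> In (l x) E1 -> In x D).
  { intros x Hx Hx1. apply NNPP. intros Hn. apply (Ml x); auto; apply in_app_iff; auto. }
  set (W := extend n w u).
  assert (HWG : forall i, i < S n -> G (W i)).
  { apply forall_lt_S; [intros i Hi; unfold W; rewrite extend_old by auto; now apply Hw|].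
    unfold W; now rewrite extend_last. }
  assert (HWE : stable (S n) W E1).
  { intros i x Hi Hx. revert i Hi. apply forall_lt_S; unfold W.
    - intros i Hi. rewrite extend_old; auto.
    - rewrite extend_last; auto. }
  (* On [E1] the amalgam acts as the given tuple, on the moved copy of [D'] as the conjugate of
     [om]. *)
  assert (Hglue : forall i, exists om', i < S n ->
     G om' /\ agree E1 om' (W i) /\ forall x, In x D' -> om' (l x) = l (om i x)).
  { intros i. destruct (le_lt_dec (S n) i) as [H|H]; [exists pid; lia|].
    destruct (glue L E1 (map l D') (W i) (l ** om i ** pinv l)) as [g [Hg [Ag1 Ag2]]]; auto.
    - now apply (down_map L).
    - apply (G_comp _ _ _ L); [apply (G_comp _ _ _ L)|]; auto. now apply (G_inv _ _ _ L).
    - intros y Hy Hy'. apply in_map_iff in Hy'. destruct Hy' as [x [<- Hx]].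
      change (W i (l x) = l (om i (pinv l (l x)))). rewrite pinvK.
      assert (HxD : In x D) by auto. rewrite (Fl x HxD). rewrite (Hag i H x HxD).
      symmetry. apply Fl. now apply Hst.
    - intros y z Hy Hz. apply in_map_iff in Hz. destruct Hz as [x [<- Hx]].
      change (W i y = l (om i (pinv l (l x))) -> y = l x). rewrite pinvK. intros E.
      assert (HomD : In (om i x) D).
      { apply Hlm; [now apply Homs|]. rewrite <- E. now apply HWE. }
      rewrite Fl in E by auto.
      assert (HxD : In x D).
      { apply (stable_rev D (om i)); auto. intros z Hz. rewrite (Hag i H z Hz). now apply Hst. }
      rewrite Fl by auto. rewrite (Hag i H x HxD) in E. now apply perm_inj in E.
    - exists g. intros _. split; auto. split; auto. intros x Hx. rewrite Ag2 by now apply in_map.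
      change (l (om i (pinv l (l x))) = l (om i x)). now rewrite pinvK. }
  destruct (choice_fun _ Hglue) as [om' Hom'].
  set (D2 := E1 ++ map l D').
  assert (Hs2 : stable (S n) om' D2).
  { intros i x Hi Hx. unfold D2 in *. rewrite in_app_iff in *. destruct (Hom' i Hi) as [_ [A1 A2]].
    destruct Hx as [Hx|Hx].
    - left. rewrite A1 by auto. now apply HWE.
    - right. apply in_map_iff in Hx. destruct Hx as [z [<- Hz]]. rewrite A2 by auto.
      apply in_map. now apply Homs. }
  (* Only the first [n] maps enter the genericity of [w]; the map of index [n] is transported by [k]
     and becomes [u']. *)
  destruct (gen_ext _ _ Hw E1 D2 om') as [k [[Hk Fk] Hki]]; auto.
  { apply down_app; auto. now apply (down_map L). }
  { intros x Hx. apply in_app_iff; auto. }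
  { intros i Hi. apply Hom'. lia. }
  { intros i x Hi. apply Hs2. lia. }
  { intros i Hi x Hx. destruct (Hom' i) as [_ [A1 _]]; [lia|]. rewrite A1 by auto.
    unfold W. now rewrite extend_old. }
  destruct (Hom' n) as [HGn [An Bn]]; [lia|].
  exists (k ** om' n ** pinv k), (k ** l). split; [|split; [|split; [split|]]].
  - apply (G_comp _ _ _ L); [now apply (G_comp _ _ _ L)|now apply (G_inv _ _ _ L)].
  - intros x Hx. change (u x = k (om' n (pinv k x))). rewrite (pinv_eq k x x) by auto.
    rewrite An by auto. unfold W. rewrite extend_last. symmetry. auto.
  - now apply (G_comp _ _ _ L).
  - intros x Hx. change (k (l x) = x). rewrite Fl by auto. apply Fk. auto.
  - intros i x Hi Hx. revert i Hi. apply forall_lt_S.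
    + intros i Hi. rewrite extend_old by auto. change (w i (k (l x)) = k (l (om i x))).
      rewrite Hki by (auto; apply in_app_iff; right; now apply in_map).
      f_equal. apply Hom'; auto; lia.
    + rewrite extend_last. change (k (om' n (pinv k (k (l x)))) = k (l (om n x))).
      rewrite pinvK. f_equal. auto.
Qed.

(** An extension problem matters only through [D], [D'] and the restrictions of [om] to [D']. Coding
    this finite data shows that there are countably many problems. *)
Definition problem_code n (D D' : list T) (om : nat -> perm T) : nat :=
  encode [encode (map c D); encode (map c D');
    encode (map (fun i => encode (map c (map (om i) D'))) (seq 0 (S n)))].

Lemma problem_code_inj n D D' om D1 D1' om1 :
  problem_code n D D' om = problem_code n D1 D1' om1 ->
  D = D1 /\ D' = D1' /\ forall i, i < S n -> agree D' (om i) (om1 i).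
Proof.
  intros E. apply encode_inj in E.
  assert (Htriple : forall a b d a' b' d' : nat,
    [a; b; d] = [a'; b'; d'] -> a = a' /\ b = b' /\ d = d') by (intros; repeat split; congruence).
  apply Htriple in E. destruct E as [E1 [E2 E3]].
  assert (Hm : forall l l' : list T, encode (map c l) = encode (map c l') -> l = l').
  { intros l l' H. apply encode_inj in H. revert H. apply map_inj. apply (code_inj _ _ _ L). }
  apply Hm in E1, E2. apply encode_inj in E3. subst D1 D1'.
  split; auto. split; auto.
  intros i Hi. cbv beta in E3.
  assert (E4 : encode (map c (map (om i) D')) = encode (map c (map (om1 i) D'))).
  { apply (proj1 map_ext_in_iff E3). apply in_seq. lia. }
  apply Hm in E4. intros x Hx. now apply (proj1 map_ext_in_iff E4).
Qed.

(** Local finiteness is required at one point at a time ([O1]) and solvability for one problem at a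
    time ([O2]). Density comes from [locally_finite_dense] and [solve_problem]. *)
Lemma generic_comeagre n w F : generic n w -> down (dn:=dn) F ->
  exists O : nat -> perm T -> Prop, (forall i, dopen F (O i)) /\
    forall u, pstab F u -> (forall i, O i u) -> generic (S n) (extend n w u).
Proof.
  intros Hw HF.
  set (hyp := fun u D D' om => down (dn:=dn) D /\ down (dn:=dn) D' /\ incl D D' /\
    stable (S n) (extend n w u) D /\ (forall i, i < S n -> G (om i)) /\ stable (S n) om D' /\
    forall i, i < S n -> agree D (om i) (extend n w u i)).
  set (O1 := fun j u => forall x, c x = j ->
    exists D, down (dn:=dn) D /\ In x D /\ stable (S n) (extend n w u) D).
  set (O2 := fun j u => forall D D' om, problem_code n D D' om = j -> hyp u D D' om ->
    exists k, pstab D k /\ forall i x, i < S n -> In x D' -> extend n w u i (k x) = k (om i x)).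
  assert (Hloc : forall D u u' i x, agree D u u' -> In x D -> extend n w u i x = extend n w u' i x).
  { intros D u u' i x H Hx. unfold extend. destruct (Nat.eqb i n); auto. }
  exists (fun j u => O1 j u /\ O2 j u). split.
  - intros j. apply dopen_and; intros g E Hg.
    + destruct (locally_finite_dense n w F g E (pts j) Hw HF Hg)
        as [u [E1 [Hu [Au [HE1 [HFE [HEE [Hl [Hs Hus]]]]]]]]].
      exists u, E1. split; auto. split; auto. intros u' Hu' Au' x Hx.
      exists E1. split; auto. split; [apply Hl; subst j; apply pts_In|].
      intros i y Hi Hy. rewrite <- (Hloc E1 u u' i y Au' Hy).
      revert i Hi. apply forall_lt_S.
      * intros i Hi. rewrite extend_old; auto.
      * rewrite extend_last; auto.
    + destruct (classic (exists D D' om, problem_code n D D' om = j /\ forall i, i < S n -> G (om i)))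
        as [[D [D' [om [Hj HGom]]]]|Hno].
      2:{ exists g, []. split; auto. split; [intros x Hx; reflexivity|].
          intros u' _ _ D D' om Hj Hh. exfalso. apply Hno. exists D, D', om. split; auto. apply Hh. }
      destruct (locally_finite_dense n w F g E (D ++ D') Hw HF Hg)
        as [u [E1 [Hu [Au [HE1 [HFE [HEE [Hl [Hs Hus]]]]]]]]].
      destruct (classic (hyp u D D' om)) as [Hhyp|Hnh].
      * destruct Hhyp as [h1 [h2 [h3 [h4 [h5 [h6 h7]]]]]].
        destruct (solve_problem n w u D D' om E1) as [u' [k [Hu' [Au' [Hk Hsol]]]]]; auto.
        { apply Hu. }
        { intros x Hx. apply Hl, in_app_iff; auto. }
        (* A solution involves [u'] only on [map k D']; freezing these values keeps it valid. *)
        exists u', (map k D'). split; [split; auto|split].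
        -- intros x Hx. rewrite <- Au' by auto. now apply Hu.
        -- intros x Hx. rewrite Au by auto. auto.
        -- intros u'' Hu'' Au'' D1 D1' om1 Hj1 _. rewrite <- Hj in Hj1.
           apply problem_code_inj in Hj1. destruct Hj1 as [-> [-> Hom1]].
           exists k. split; auto. intros i x Hi Hx.
           rewrite <- (Hloc (map k D') u' u'') by (auto; now apply in_map).
           rewrite Hom1 by auto. now apply Hsol.
      (* Whether the hypotheses of the problem hold depends on [u] only through its values on [D],
         so they also fail for all nearby elements. *)
      * exists u, (D ++ D'). split; auto. split; auto.
        intros u' Hu' Au' D1 D1' om1 Hj1 Hh. exfalso. apply Hnh. rewrite <- Hj in Hj1.
        apply problem_code_inj in Hj1. destruct Hj1 as [-> [-> Hom1]].
        destruct Hh as [h1 [h2 [h3 [h4 [h5 [h6 h7]]]]]].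
        assert (Hom : forall i x, i < S n -> In x D' -> om i x = om1 i x).
        { intros i x Hi Hx. symmetry. now apply Hom1. }
        assert (Hext : forall i x, In x D -> extend n w u i x = extend n w u' i x).
        { intros i x Hx. apply (Hloc (D ++ D')); auto. apply in_app_iff; auto. }
        repeat split; auto.
        -- intros i x Hi Hx. rewrite Hext by auto. now apply h4.
        -- intros i x Hi Hx. rewrite Hom by auto. now apply h6.
        -- intros i Hi x Hx. rewrite Hom, Hext by auto. now apply h7.
  - intros u Hu HO. split.
    + apply forall_lt_S; [intros i Hi; rewrite extend_old by auto; now apply Hw|].
      rewrite extend_last. apply Hu.
    + intros x. apply (proj1 (HO (c x))). reflexivity.
    + intros D D' om h1 h2 h3 h4 h5 h6 h7.
      apply (proj2 (HO (problem_code n D D' om)) D D' om); auto. repeat split; auto.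
Qed.

End Generic.

(** * The small index property for layered groups *)

Section SmallIndex.

Context {T : Type} {c : T -> nat} {dn : T -> list T} {G : perm T -> Prop}.
Hypothesis L : layered c dn G.
Context {H : perm T -> Prop}.
Hypothesis H_comp : forall g h, H g -> H h -> H (g ** h).
Hypothesis H_inv : forall g, H g -> H (pinv g).
Hypothesis small : ~ exists phi : (nat -> bool) -> perm T,
  (forall s, G (phi s)) /\ forall s t, s <> t -> ~ H (pinv (phi s) ** phi t).

(** Otherwise all quotients of the family from [mycielski] would lie outside [H], giving continuum
    many cosets. *)
Lemma small_index_meets F (O : nat -> perm T -> Prop) :
  (forall i, dopen (G:=G) F (O i)) -> exists u, pstab (G:=G) F u /\ H u /\ forall i, O i u.
Proof.
  intros HO. destruct (mycielski L F O HO) as [phi [Hphi Hsep]].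
  apply NNPP. intros Hn. apply small. exists phi. split; [intros s; apply Hphi|].
  intros s t Hst Hh. apply Hn. exists (pinv (phi s) ** phi t). split; auto.
  apply (pstab_comp L); auto. now apply (pstab_inv L).
Qed.

(** An element [v] of the stabiliser outside [H] is the product of [u] and [pinv u ** v]. For
    generic [u] both factors meet all requirements, and one of them is outside [H]. A single
    quotient from [mycielski] serves as [u]. *)
Lemma not_open_avoids F (O : nat -> perm T -> Prop) :
  ~ (forall g, G g -> fixes F g -> H g) ->
  (forall i, dopen (G:=G) F (O i)) -> exists v, pstab (G:=G) F v /\ ~ H v /\ forall i, O i v.
Proof.
  intros Hno HO.
  assert (Hv : exists v, pstab (G:=G) F v /\ ~ H v).
  { apply NNPP. intros Hn. apply Hno. intros g Hg Fg. apply NNPP. intros Hg'.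
    apply Hn. exists g. split; auto. split; auto. }
  destruct Hv as [v [HKv Hv]].
  destruct (mycielski L F (fun i u => O i u /\ O i (pinv u ** v))) as [phi [Hphi Hsep]].
  { intros i. apply dopen_and; auto. now apply (dopen_twist L). }
  set (u := pinv (phi (fun _ => true)) ** phi (fun _ => false)).
  assert (HO' : forall i, O i u /\ O i (pinv u ** v)).
  { intros i. apply Hsep. intros E. apply (f_equal (fun s => s 0)) in E. discriminate. }
  assert (Hu : pstab (G:=G) F u) by (apply (pstab_comp L); auto; now apply (pstab_inv L)).
  destruct (classic (H u)) as [HHu|HHu].
  - exists (pinv u ** v). split; [apply (pstab_comp L); auto; now apply (pstab_inv L)|].
    split; [|intros i; apply HO']. intros HH. apply Hv.
    replace v with (u ** (pinv u ** v)); auto.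
    apply perm_ext. intros x. apply (pinvVK u).
  - exists u. split; auto. split; auto. intros i. apply HO'.
Qed.

(** Take [F] down-closed and [w]-stable. Generic [u] in [H] and [v] outside [H] both fix [F], so the
    two extended tuples agree there and are conjugate over [F]. Since they share the entries of [w],
    the conjugator commutes with these. *)
Lemma splitting n w l : (forall F, ~ (forall g, G g -> fixes F g -> H g)) ->
  generic (G:=G) (dn:=dn) n w ->
  exists F u v k, incl l F /\ H u /\ ~ H v /\
    generic (G:=G) (dn:=dn) (S n) (extend n w u) /\ generic (G:=G) (dn:=dn) (S n) (extend n w v) /\
    pstab (G:=G) F k /\ (forall i x, i < n -> k (w i x) = w i (k x)) /\ forall x, k (u x) = v (k x).
Proof.
  intros Hno Hw.
  destruct (gen_lf_list n w l Hw) as [F [HF [HlF HsF]]].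
  destruct (generic_comeagre L n w F Hw HF) as [O [HO Hgen]].
  destruct (small_index_meets F O HO) as [u [HKu [Hu HOu]]].
  destruct (not_open_avoids F O (Hno F) HO) as [v [HKv [Hv HOv]]].
  destruct (generic_conj L (S n) (extend n w u) (extend n w v) F) as [k [Hk Hc]]; auto.
  - intros i x Hi Hx. revert i Hi. apply forall_lt_S.
    + intros i Hi. rewrite extend_old; auto.
    + rewrite extend_last. now rewrite (proj2 HKu).
  - apply forall_lt_S.
    + intros i Hi x Hx. now rewrite !extend_old.
    + intros x Hx. rewrite !extend_last. rewrite (proj2 HKu), (proj2 HKv); auto.
  - exists F, u, v, k. split; auto. split; auto. split; auto. split; auto. split; auto.
    split; auto. split.
    + intros i x Hi. specialize (Hc i x). rewrite !extend_old in Hc by auto. apply Hc. lia.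
    + intros x. specialize (Hc n x). rewrite !extend_last in Hc. apply Hc. lia.
Qed.

(** * The binary tree of conjugators *)

Record node := Node { tuple : nat -> perm T; conjugator : perm T; support : list T }.

Definition valid n (a : node) := generic (G:=G) (dn:=dn) n (tuple a) /\ G (conjugator a).

(** Passing to a child preserves the conjugates of the old entries; by [step_split] the two new
    entries, one in [H] and one outside, have the same conjugate. [step_dom] enlarges the support so
    that limits along branches are total and onto. *)
Record step_spec n (a : node) (b : bool -> node) : Prop := {
  step_valid : forall i, valid (S n) (b i);
  step_dom : forall i, incl (support a ++ pts L n ++ map (pinv (conjugator a)) (pts L n)) (support (b i));
  step_hh : forall i, agree (support (b i)) (conjugator a) (conjugator (b i));
  step_tup : forall i j, j < n -> tuple (b i) j = tuple a j;
  step_conj : forall i j x, j < n ->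
    conjugator (b i) (tuple a j (pinv (conjugator (b i)) x)) = conjugator a (tuple a j (pinv (conjugator a) x));
  step_split : forall x, conjugator (b true) (tuple (b true) n (pinv (conjugator (b true)) x)) =
                         conjugator (b false) (tuple (b false) n (pinv (conjugator (b false)) x));
  step_in : H (tuple (b true) n);
  step_out : ~ H (tuple (b false) n) }.

Lemma step_exists n a : (forall F, ~ (forall g, G g -> fixes F g -> H g)) ->
  valid n a -> exists b, step_spec n a b.
Proof.
  intros Hno [Hgen Hh].
  destruct (splitting n (tuple a) (support a ++ pts L n ++ map (pinv (conjugator a)) (pts L n)) Hno Hgen)
    as [F [u [v [k [Hl [Hu [Hv [Gu [Gv [[Hk Fk] [Hkw Hkuv]]]]]]]]]]].
  assert (Fk' : forall x, In x F -> pinv k x = x) by (intros x Hx; apply pinv_eq; auto).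
  (* As [k ** u] equals [v ** k], composing the conjugator with [pinv k] gives [v] the conjugate
     that [u] has under the old one. Old entries commute with [k], and [k] fixes the new support
     [F]. *)
  exists (fun i : bool => if i then Node (extend n (tuple a) u) (conjugator a) F
                          else Node (extend n (tuple a) v) (conjugator a ** pinv k) F).
  split.
  - intros [|]; split; simpl; auto. apply (G_comp _ _ _ L); auto. now apply (G_inv _ _ _ L).
  - intros [|]; simpl; auto.
  - intros [|] x Hx; cbn [conjugator support] in *; auto.
    change (conjugator a x = conjugator a (pinv k x)). now rewrite Fk'.
  - intros [|] j Hj; cbn [tuple]; now apply extend_old.
  - intros [|] j x Hj; cbn [conjugator]; auto.
    change (conjugator a (pinv k (tuple a j (k (pinv (conjugator a) x)))) = conjugator a (tuple a j (pinv (conjugator a) x))).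
    rewrite <- Hkw by auto. now rewrite pinvK.
  - intros x. cbn [conjugator tuple]. rewrite !extend_last.
    change (conjugator a (u (pinv (conjugator a) x)) = conjugator a (pinv k (v (k (pinv (conjugator a) x))))).
    rewrite <- Hkuv. now rewrite pinvK.
  - cbn [tuple]. now rewrite extend_last.
  - cbn [tuple]. now rewrite extend_last.
Qed.

(* Kechris-Rosendal tree: along the branches through the two children of a node, the
   limits conjugate an element of H and a non-element of H to the same element of G. *)
Theorem layered_small_index : exists F, forall g, G g -> fixes F g -> H g.
Proof.
  apply NNPP. intros Hn.
  assert (Hno : forall F, ~ (forall g, G g -> fixes F g -> H g)).
  { intros F HF. apply Hn. eauto. }
  assert (Hst : forall p : nat * node, exists b, valid (fst p) (snd p) -> step_spec (fst p) (snd p) b).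
  { intros [n a]; simpl. destruct (classic (valid n a)) as [Hv|Hv].
    - destruct (step_exists n a Hno Hv) as [b Hb]. eauto.
    - exists (fun _ => a). tauto. }
  destruct (choice_fun _ Hst) as [nx Hnx].
  set (st := fun s : nat -> bool => fix st n :=
    match n with 0 => Node (fun _ => pid) pid [] | S n => nx (n, st n) (s n) end).
  assert (Hval : forall s n, valid n (st s n)).
  { intros s. induction n as [|n IH].
    - split; [apply (generic0 L)|apply (G_id _ _ _ L)].
    - simpl. apply (step_valid _ _ _ (Hnx (n, st s n) IH)). }
  assert (Hsp : forall s n, step_spec n (st s n) (nx (n, st s n))).
  { intros s n. apply (Hnx (n, st s n)), Hval. }
  assert (Hlim : forall s, exists h, G h /\ forall n, agree (support (st s n)) h (conjugator (st s n))).
  { intros s. apply (limit L).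
    - intros n. apply Hval.
    - intros n x Hx. apply (step_dom _ _ _ (Hsp s n) (s n)). apply in_app_iff; auto.
    - intros n x Hx. apply (step_hh _ _ _ (Hsp s n) (s n)).
      apply (step_dom _ _ _ (Hsp s n) (s n)). apply in_app_iff; auto.
    - intros x. exists (S (c x)). apply (step_dom _ _ _ (Hsp s (c x)) (s (c x))).
      rewrite !in_app_iff. right; left. apply pts_In.
    - intros y. exists (S (c y)), (pinv (conjugator (st s (c y))) y).
      assert (Hin : In (pinv (conjugator (st s (c y))) y) (support (st s (S (c y))))).
      { apply (step_dom _ _ _ (Hsp s (c y)) (s (c y))).
        rewrite !in_app_iff. right; right. apply in_map. apply pts_In. }
      split; auto. simpl. rewrite <- (step_hh _ _ _ (Hsp s (c y)) (s (c y))) by exact Hin.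
      apply pinvVK. }
  destruct (choice_fun _ Hlim) as [phi Hphi].
  assert (Hmono : forall s n m, n <= m -> incl (support (st s n)) (support (st s m))).
  { intros s n m Hnm. induction Hnm as [|m Hnm IH]; [apply incl_refl|].
    intros x Hx. apply (step_dom _ _ _ (Hsp s m) (s m)). apply in_app_iff; auto. }
  assert (Hconst : forall s j n, j < n -> tuple (st s n) j = tuple (st s (S j)) j /\
    forall x, conjugator (st s n) (tuple (st s (S j)) j (pinv (conjugator (st s n)) x)) =
              conjugator (st s (S j)) (tuple (st s (S j)) j (pinv (conjugator (st s (S j))) x))).
  { intros s j n Hj. induction Hj as [|n Hj [IH1 IH2]]; [auto|].
    pose proof (Hsp s n) as Hs. split.
    - rewrite <- IH1. apply (step_tup _ _ _ Hs); auto.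
    - intros x. rewrite <- IH2, <- IH1. apply (step_conj _ _ _ Hs); auto. }
  (* The conjugate of entry [j] is constant from level [j + 1] on, and at a late level [n] the limit
     and the conjugator agree at the two points [y] and [z] involved. *)
  assert (Hphi_conj : forall s j x, phi s (tuple (st s (S j)) j (pinv (phi s) x)) =
     conjugator (st s (S j)) (tuple (st s (S j)) j (pinv (conjugator (st s (S j))) x))).
  { intros s j x. set (y := pinv (phi s) x). set (z := tuple (st s (S j)) j y).
    set (n := S (max j (max (c y) (c z)))).
    assert (Hin : forall t, c t < n -> In t (support (st s n))).
    { intros t Ht. apply (Hmono s (S (c t))); [lia|].
      apply (step_dom _ _ _ (Hsp s (c t)) (s (c t))).
      rewrite !in_app_iff. right; left. apply pts_In. }
    destruct (Hconst s j n) as [_ Hc]; [unfold n; lia|]. rewrite <- Hc.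
    rewrite (proj2 (Hphi s) n z) by (apply Hin; unfold n; lia).
    f_equal. unfold z. f_equal. symmetry. apply pinv_eq.
    rewrite <- (proj2 (Hphi s) n y) by (apply Hin; unfold n; lia). apply pinvVK. }
  assert (Hkey : forall s t n, (forall i, i < n -> s i = t i) -> s n = true -> t n = false ->
     ~ H (pinv (phi s) ** phi t)).
  { intros s t n Heq Hs Ht HH.
    assert (Est : st s n = st t n).
    { clear Hs Ht. induction n as [|n IH]; auto. simpl. rewrite IH by auto. now rewrite Heq by auto. }
    pose proof (Hsp s n) as Hsn.
    assert (Es : st s (S n) = nx (n, st s n) true) by (simpl; now rewrite Hs).
    assert (Et : st t (S n) = nx (n, st s n) false) by (simpl; now rewrite Ht, Est).
    set (u := tuple (nx (n, st s n) true) n) in *. set (v := tuple (nx (n, st s n) false) n) in *.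
    apply (step_out _ _ _ Hsn). fold v.
    set (a := pinv (phi s) ** phi t) in *.
    (* The two limits conjugate [u] and [v] to the same permutation, so [v] is a conjugate of [u] by
       [a]; with [a] in [H] it would be in [H] too. *)
    replace v with (pinv a ** u ** a).
    { apply H_comp; auto. apply H_comp; auto. apply (step_in _ _ _ Hsn). }
    apply perm_ext. intros x. apply (perm_inj (phi t)).
    pose proof (Hphi_conj s n (phi t x)) as E1. pose proof (Hphi_conj t n (phi t x)) as E2.
    rewrite Es in E1. rewrite Et, pinvK in E2. fold u in E1. fold v in E2.
    rewrite E2. pose proof (step_split _ _ _ Hsn (phi t x)) as E3. fold u v in E3.
    rewrite <- E3, <- E1.
    change (phi t (pinv (phi t) (phi s (u (pinv (phi s) (phi t x))))) =
            phi s (u (pinv (phi s) (phi t x)))).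
    apply pinvVK. }
  apply small. exists phi. split; [intros s; apply Hphi|].
  intros s t Hst' HH. destruct (first_difference s t Hst') as [n [Hn' Hlt]].
  destruct (s n) eqn:Es, (t n) eqn:Et; try congruence.
  - exact (Hkey s t n Hlt Es Et HH).
  - apply (Hkey t s n); auto.
    + intros i Hi. symmetry. auto.
    + replace (pinv (phi t) ** phi s) with (pinv (pinv (phi s) ** phi t)); auto.
      apply perm_ext. reflexivity.
Qed.

End SmallIndex.

(** * The predimension *)

Definition deg (e : nat -> nat -> bool) x (B : list nat) := length (filter (e x) B).

Fixpoint cross (e : nat -> nat -> bool) (A B : list nat) :=
  match A with [] => 0 | a :: A => deg e a B + cross e A B end.

Fixpoint edges (e : nat -> nat -> bool) (A : list nat) :=
  match A with [] => 0 | a :: A => deg e a A + edges e A end.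

Lemma deg_app e x A B : deg e x (A ++ B) = deg e x A + deg e x B.
Proof. unfold deg. now rewrite filter_app, length_app. Qed.

Lemma cross_app_r e A B C : cross e A (B ++ C) = cross e A B + cross e A C.
Proof. induction A as [|a A IH]; simpl; auto. rewrite deg_app. lia. Qed.

Lemma edges_app e A B : edges e (A ++ B) = edges e A + edges e B + cross e A B.
Proof. induction A as [|a A IH]; simpl; [lia|]. rewrite deg_app. lia. Qed.

Lemma deg_perm e x A B : Permutation A B -> deg e x A = deg e x B.
Proof.
  intros H. unfold deg. induction H; simpl; auto; try congruence.
  - destruct (e x x0); simpl; congruence.
  - destruct (e x x0), (e x y); simpl; auto.
Qed.

Lemma edges_perm e A B : (forall x y, e x y = e y x) -> Permutation A B -> edges e A = edges e B.
Proof.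
  intros He H. induction H; simpl; auto; try congruence.
  - rewrite (deg_perm e x _ _ H). congruence.
  - unfold deg. simpl. rewrite (He y x). destruct (e x y); simpl; lia.
Qed.

Lemma edges_map e e' f A : (forall x y, In x A -> In y A -> e (f x) (f y) = e' x y) ->
  edges e (map f A) = edges e' A.
Proof.
  induction A as [|a A IH]; simpl; auto. intros H. rewrite IH by auto. f_equal.
  unfold deg. assert (HA : forall y, In y A -> e (f a) (f y) = e' a y) by auto.
  clear - HA. induction A as [|b A IH]; simpl; auto.
  rewrite HA by (simpl; auto). destruct (e' a b); simpl; rewrite IH; auto; simpl in *; auto.
Qed.

Lemma cross_zero e A B : cross e A B = 0 <-> forall x y, In x A -> In y B -> e x y = false.
Proof.
  assert (Hd : forall x B, deg e x B = 0 <-> forall y, In y B -> e x y = false).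
  { clear. intros x B. unfold deg. induction B as [|b B IH]; simpl; [tauto|].
    destruct (e x b) eqn:E; simpl.
    - split; [discriminate|]. intros H. rewrite H in E by auto. discriminate.
    - rewrite IH. split; intros H y; [intros [<-|Hy]|]; auto. }
  induction A as [|a A IH]; simpl; [tauto|]. split.
  - intros H x y [<-|Hx] Hy.
    + apply (proj1 (Hd a B)); auto. lia.
    + apply IH; auto. lia.
  - intros H. assert (deg e a B = 0) by (apply Hd; auto).
    assert (cross e A B = 0) by (apply IH; auto). lia.
Qed.

(** An edge at the new vertex [a] is counted once by [nedges], in the row or in the column of [a]
    according to the order of its ends; the diagonal contributes nothing. *)
Lemma nedges_edges e A : is_graph e -> NoDup A -> nedges e A = edges e A.
Proof.
  intros [Hsym Hirr] HA. unfold nedges.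
  set (q := fun p : nat * nat => (fst p <? snd p) && e (fst p) (snd p)).
  assert (Hl : forall x A B, length (filter q (list_prod (x :: A) B)) =
    length (filter (fun y => (x <? y) && e x y) B) + length (filter q (list_prod A B))).
  { intros x A' B. simpl. rewrite filter_app, length_app. f_equal.
    induction B as [|b B IH]; simpl; auto. unfold q at 1. simpl.
    destruct ((x <? b) && e x b); simpl; congruence. }
  assert (Hr : forall x A B, length (filter q (list_prod A (x :: B))) =
    length (filter (fun y => (y <? x) && e y x) A) + length (filter q (list_prod A B))).
  { intros x A' B. induction A' as [|a A' IH]; auto. rewrite !Hl, IH. simpl.
    destruct (a <? x); simpl; destruct (e a x); simpl; lia. }
  induction A as [|a A IH]; auto. inversion HA as [|? ? Ha HA']; subst.
  rewrite Hl, Hr, IH by auto. simpl. rewrite Hirr, Bool.andb_false_r. simpl.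
  rewrite Nat.add_assoc. f_equal. unfold deg. clear - Ha Hsym.
  induction A as [|b A IH]; auto. simpl in Ha. simpl. rewrite (Hsym b a).
  assert (IH' := IH (fun H => Ha (or_intror H))).
  destruct (Nat.ltb_spec a b), (Nat.ltb_spec b a), (e a b); simpl; try lia.
  all: exfalso; apply Ha; left; lia.
Qed.

Definition union (A B : list nat) := A ++ sel (fun x => ~ In x A) B.
Definition inter (A B : list nat) := sel (fun x => In x B) A.
Definition diff (A B : list nat) := sel (fun x => ~ In x B) A.

Lemma NoDup_sel {T} (P : T -> Prop) l : NoDup l -> NoDup (sel P l).
Proof. apply NoDup_filter. Qed.

Lemma union_In A B x : In x (union A B) <-> In x A \/ In x B.
Proof. unfold union. rewrite in_app_iff, sel_In. destruct (classic (In x A)); tauto. Qed.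

Lemma inter_In A B x : In x (inter A B) <-> In x A /\ In x B.
Proof. unfold inter. now rewrite sel_In. Qed.

Lemma diff_In A B x : In x (diff A B) <-> In x A /\ ~ In x B.
Proof. unfold diff. now rewrite sel_In. Qed.

Lemma NoDup_union A B : NoDup A -> NoDup B -> NoDup (union A B).
Proof.
  intros HA HB. apply NoDup_app; auto; [now apply NoDup_sel|].
  intros x Hx Hx'. rewrite sel_In in Hx'. tauto.
Qed.

Lemma NoDup_map_in {A B} (f : A -> B) l :
  (forall x y, In x l -> In y l -> f x = f y -> x = y) -> NoDup l -> NoDup (map f l).
Proof.
  intros Hf Hl. induction Hl as [|a l Ha Hl IH]; simpl; constructor.
  - intros H. apply in_map_iff in H. destruct H as [b [E Hb]].
    apply Hf in E; simpl; auto. now subst.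
  - apply IH. intros; apply Hf; simpl; auto.
Qed.

Section Delta.

Variable m : nat.
Local Open Scope Z_scope.

Lemma delta_edges e A : is_graph e -> NoDup A ->
  delta m e A = Z.of_nat (m * length A) - Z.of_nat (edges e A).
Proof. intros He HA. unfold delta. now rewrite nedges_edges. Qed.

Lemma delta_ext e A B : is_graph e -> NoDup A -> NoDup B -> (forall x, In x A <-> In x B) ->
  delta m e A = delta m e B.
Proof.
  intros He HA HB H. rewrite !delta_edges by auto.
  pose proof (NoDup_Permutation HA HB H) as HP.
  rewrite (Permutation_length HP). rewrite (edges_perm e A B); auto. apply He.
Qed.

Lemma delta_map e e' f A : is_graph e -> is_graph e' -> NoDup A ->
  (forall x y, In x A -> In y A -> f x = f y -> x = y) ->
  (forall x y, In x A -> In y A -> e (f x) (f y) = e' x y) ->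
  delta m e (map f A) = delta m e' A.
Proof.
  intros He He' HA Hinj H. rewrite !delta_edges; auto; [|now apply NoDup_map_in].
  rewrite length_map. now rewrite (edges_map e e' f A H).
Qed.

(** After splitting into the intersection and the two differences, the only edges of the union
    inside neither set run between the differences. *)
Lemma delta_modular e A B : is_graph e -> NoDup A -> NoDup B ->
  delta m e (union A B) + delta m e (inter A B) =
  delta m e A + delta m e B - Z.of_nat (cross e (diff A B) (diff B A)).
Proof.
  intros He HA HB.
  set (Q := inter A B). set (P := diff A B). set (R := diff B A).
  assert (HQ : NoDup Q) by now apply NoDup_sel.
  assert (HP : NoDup P) by now apply NoDup_sel.
  assert (HR : NoDup R) by now apply NoDup_sel.
  assert (HPR : NoDup (P ++ R)).
  { apply NoDup_app; auto. intros x. unfold P, R. rewrite !diff_In. tauto. }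
  assert (HQP : NoDup (Q ++ P)).
  { apply NoDup_app; auto. intros x. unfold P, Q. rewrite diff_In, inter_In. tauto. }
  assert (HQR : NoDup (Q ++ R)).
  { apply NoDup_app; auto. intros x. unfold R, Q. rewrite diff_In, inter_In. tauto. }
  assert (HQPR : NoDup (Q ++ P ++ R)).
  { apply NoDup_app; auto. intros x. unfold P, Q, R. rewrite in_app_iff, !diff_In, inter_In. tauto. }
  assert (dec : forall (x : nat) C, In x C \/ ~ In x C) by (intros; apply classic).
  rewrite (delta_ext e (union A B) (Q ++ P ++ R)), (delta_ext e A (Q ++ P)),
    (delta_ext e B (Q ++ R)); auto.
  - rewrite !delta_edges by auto. rewrite !edges_app, !length_app, !cross_app_r. lia.
  - intros x. unfold Q, R. rewrite in_app_iff, inter_In, diff_In. destruct (dec x A); tauto.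
  - intros x. unfold Q, P. rewrite in_app_iff, inter_In, diff_In. destruct (dec x B); tauto.
  - now apply NoDup_union.
  - intros x. unfold Q, P, R. rewrite !in_app_iff, inter_In, !diff_In, union_In.
    destruct (dec x A), (dec x B); tauto.
Qed.

Lemma closed_M_iff e C : closed_M m e C <->
  NoDup C /\ forall B, NoDup B -> incl C B -> delta m e C <= delta m e B.
Proof.
  split.
  - intros [HC [_ H]]. split; auto. intros B HB HCB.
    destruct (H B HB HCB) as [_ [_ [_ H']]]; auto. apply H'; auto. apply incl_refl.
  - intros [HC H]. split; auto. split; auto. intros B HB HCB _.
    split; [auto|split; [auto|split; auto]].
Qed.

Lemma closed_inter_le e C B : is_graph e -> closed_M m e C -> NoDup B ->
  delta m e (inter B C) <= delta m e B.
Proof.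
  intros He HC HB. apply closed_M_iff in HC. destruct HC as [HC Hle].
  pose proof (delta_modular e B C He HB HC).
  assert (delta m e C <= delta m e (union B C)).
  { apply Hle; [now apply NoDup_union|]. intros x Hx. apply union_In; auto. }
  lia.
Qed.

(** Cutting a superset of [inter C D] first with [C] and then with [D] never raises the
    predimension, and ends at [inter C D]. *)
Lemma closed_inter e C D : is_graph e -> closed_M m e C -> closed_M m e D ->
  closed_M m e (inter C D).
Proof.
  intros He HC HD.
  assert (NC : NoDup C) by exact (proj1 HC).
  apply closed_M_iff. split; [now apply NoDup_sel|]. intros B HB HCB.
  pose proof (closed_inter_le e C B He HC HB).
  pose proof (closed_inter_le e D (inter B C) He HD (NoDup_sel _ _ HB)).
  rewrite (delta_ext e (inter C D) (inter (inter B C) D)); auto; try lia.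
  - now apply NoDup_sel.
  - now apply NoDup_sel, NoDup_sel.
  - intros x. rewrite !inter_In. split; [|tauto]. intros Hx. split; [|tauto].
    split; [|tauto]. apply HCB. now apply inter_In.
Qed.

End Delta.

(** * Closures and free amalgamation in the generic graph *)

Section FreeAmalgam.

Context {m : nat} {e : nat -> nat -> bool}.
Hypothesis Hgen : is_generic m e.

Lemma gen_graph : is_graph e.
Proof. apply Hgen. Qed.

Lemma gen_homogeneous A B f : closed_M m e A -> closed_M m e B -> Permutation (map f A) B ->
  (forall x y, In x A -> In y A -> e (f x) (f y) = e x y) ->
  exists g, is_automorphism e g /\ forall x, In x A -> g x = f x.
Proof. apply Hgen. Qed.

(** The chain provides a closed superset. One of least length lies in every other, since closed sets
    intersect in closed sets. *)
Lemma cl_exists A : exists C, is_cl m e A C.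
Proof.
  assert (Hex : exists C, closed_M m e C /\ incl A C).
  { destruct Hgen as [_ [_ [[C [HC [Hinc Hcov]]] _]]].
    assert (Hmon : forall n k, n <= k -> incl (C n) (C k)).
    { intros n k H. induction H; [apply incl_refl|]. eapply incl_tran; eauto. }
    assert (Hn : exists n, incl A (C n)).
    { induction A as [|a A [n IH]]; [exists 0; intros x []|].
      destruct (Hcov a) as [k Hk]. exists (max n k). intros x [<-|Hx].
      - apply (Hmon k); auto. lia.
      - apply (Hmon n); [lia|auto]. }
    destruct Hn as [n Hn]. eauto. }
  destruct Hex as [C HC]. remember (length C) as n eqn:En. revert C En HC.
  induction n as [n IH] using lt_wf_ind. intros C -> [HC HAC].
  destruct (classic (exists D, closed_M m e D /\ incl A D /\ ~ incl C D)) as [[D [HD [HAD Hn]]]|Hn].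
  - assert (Hx : exists x, In x C /\ ~ In x D).
    { apply NNPP. intros H. apply Hn. intros x Hx. apply NNPP. eauto. }
    destruct Hx as [x [HxC HxD]].
    apply (IH (length (inter C D))) with (C := inter C D); auto.
    + apply Nat.nle_gt. intros Hl. apply HxD.
      assert (Hi : incl C (inter C D)).
      { apply (NoDup_length_incl (NoDup_sel _ _ (proj1 HC)) Hl).
        intros y Hy. apply inter_In in Hy. tauto. }
      apply Hi, inter_In in HxC. tauto.
    + split; [now apply closed_inter; [apply gen_graph| |]|].
      intros y Hy. apply inter_In. auto.
  - exists C. split; auto. split; auto. intros D HD HAD. apply NNPP. intros H. apply Hn. eauto.
Qed.

(* The abstract graph consists of two copies of Y = Z ++ P glued along Z: the indices
   below d + p list Z ++ P, the last p indices are the second copy of P. *)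
Lemma free_copy Z Y : closed_M m e Z -> closed_M m e Y -> incl Z Y ->
  exists f : nat -> nat, (forall x, In x Z -> f x = x) /\
    (forall x y, In x Y -> In y Y -> f x = f y -> x = y) /\
    (forall x y, In x Y -> In y Y -> e (f x) (f y) = e x y) /\
    (forall x, In x Y -> ~ In x Z -> ~ In (f x) Y).
Proof.
  intros HZ HY HZY. pose proof gen_graph as He.
  assert (NZ : NoDup Z) by exact (proj1 HZ). assert (NY : NoDup Y) by exact (proj1 HY).
  set (P := diff Y Z). set (L := Z ++ P). set (d := length Z). set (p := length P).
  set (n := d + p + p).
  assert (NL : NoDup L).
  { apply NoDup_app; auto; [now apply NoDup_sel|]. intros x. unfold P. rewrite diff_In. tauto. }
  assert (HLY : forall x, In x L <-> In x Y).
  { intros x. unfold L, P. rewrite in_app_iff, diff_In. destruct (classic (In x Z)).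
    - split; auto.
    - tauto. }
  assert (HLl : length L = d + p) by apply length_app.
  assert (HnZ : forall i, i < d -> In (nth i L 0) Z).
  { intros i Hi. unfold L. rewrite app_nth1 by auto. now apply nth_In. }
  assert (HnP : forall i, d <= i < d + p -> In (nth i L 0) P).
  { intros i Hi. unfold L. rewrite app_nth2 by (fold d; lia). apply nth_In. fold d p. lia. }
  (* [pi] folds the second copy of [P] onto the first; [xb] detects pairs joining the two copies,
     which carry no edge of [e']. *)
  set (r := fun i => if i <? d + p then i else i - p).
  set (pi := fun i => nth (r i) L 0).
  set (xb := fun i j => (d <=? i) && (i <? d + p) && (d + p <=? j)).
  set (e' := fun i j => if xb i j || xb j i then false else e (pi i) (pi j)).
  assert (He' : is_graph e').
  { split; intros x; unfold e'.
    - intros y. rewrite Bool.orb_comm. destruct (xb y x || xb x y); auto. apply He.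
    - destruct (xb x x || xb x x); auto. apply He. }
  assert (Hpi : forall i j, r i < d + p -> r j < d + p -> pi i = pi j -> r i = r j).
  { intros i j Hi Hj E. apply (proj1 (NoDup_nth L 0) NL); auto; lia. }
  assert (Hr1 : forall i, i < d + p -> r i = i).
  { intros i Hi. unfold r. destruct (Nat.ltb_spec i (d + p)); lia. }
  assert (Hr2 : forall i, d + p <= i -> r i = i - p).
  { intros i Hi. unfold r. destruct (Nat.ltb_spec i (d + p)); lia. }
  assert (Hxb : forall i j, xb i j = true <-> d <= i < d + p /\ d + p <= j).
  { intros i j. unfold xb. rewrite !Bool.andb_true_iff, !Nat.leb_le, Nat.ltb_lt. lia. }
  assert (He'1 : forall i j, i < d + p -> j < d + p -> e (pi i) (pi j) = e' i j).
  { intros i j Hi Hj. unfold e'.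
    destruct (xb i j) eqn:E1; [apply Hxb in E1; lia|].
    destruct (xb j i) eqn:E2; [apply Hxb in E2; lia|]. reflexivity. }
  assert (He'2 : forall i j, (i < d \/ d + p <= i) -> (j < d \/ d + p <= j) -> e (pi i) (pi j) = e' i j).
  { intros i j Hi Hj. unfold e'.
    destruct (xb i j) eqn:E1; [apply Hxb in E1; lia|].
    destruct (xb j i) eqn:E2; [apply Hxb in E2; lia|]. reflexivity. }
  assert (He'x : forall i j, d <= i < d + p -> d + p <= j -> e' i j = false).
  { intros i j Hi Hj. unfold e'. now rewrite (proj2 (Hxb i j)). }
  (* Dropping the second copy of [P] never raises the predimension. This gives both that [e'] has
     nonnegative predimension and that the first copy is closed. *)
  assert (Hle : forall S, NoDup S -> (forall i, In i S -> i < n) ->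
    (delta m e' (sel (fun i => (i < d + p)%nat) S) <= delta m e' S)%Z).
  { intros S HS HSn.
    set (S1 := sel (fun i => i < d + p) S).
    set (S2 := sel (fun i => i < d \/ d + p <= i) S).
    assert (NS1 : NoDup S1) by now apply NoDup_sel.
    assert (NS2 : NoDup S2) by now apply NoDup_sel.
    pose proof (delta_modular m e' S1 S2 He' NS1 NS2) as Hm.
    rewrite (proj2 (cross_zero e' (diff S1 S2) (diff S2 S1))) in Hm.
    2:{ intros x y Hx Hy. rewrite diff_In in Hx, Hy. unfold S1, S2 in Hx, Hy.
        rewrite !sel_In in Hx, Hy.
        assert (HxS : In x S) by tauto. assert (HyS : In y S) by tauto.
        apply He'x.
        - destruct Hx as [[_ H1] H2]. split; auto. apply Nat.nlt_ge. intros H. apply H2. auto.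
        - apply Nat.nlt_ge. intros H. destruct Hy as [_ H2]. apply H2. auto. }
    rewrite (delta_ext m e' (union S1 S2) S) in Hm; auto; [|now apply NoDup_union|].
    2:{ intros x. rewrite union_In. unfold S1, S2. rewrite !sel_In.
        destruct (le_lt_dec (d + p) x); tauto. }
    (* It is enough to compare inside [S2], which [pi] maps isomorphically into [Y]; the part kept
       becomes the intersection with the closed set [Z]. *)
    enough (delta m e' (inter S1 S2) <= delta m e' S2)%Z by lia.
    assert (Hinj : forall i j, In i S2 -> In j S2 -> pi i = pi j -> i = j).
    { intros i j Hi Hj E. unfold S2 in Hi, Hj. rewrite sel_In in Hi, Hj.
      destruct Hi as [Hi Hi'], Hj as [Hj Hj']. apply HSn in Hi, Hj. unfold n in *.
      assert (Hri : r i < d + p).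
      { destruct Hi'; [rewrite Hr1|rewrite Hr2]; lia. }
      assert (Hrj : r j < d + p).
      { destruct Hj'; [rewrite Hr1|rewrite Hr2]; lia. }
      apply Hpi in E; auto.
      destruct Hi' as [Hi'|Hi'], Hj' as [Hj'|Hj'];
        rewrite ?(Hr1 i), ?(Hr1 j), ?(Hr2 i), ?(Hr2 j) in E by lia; lia. }
    assert (HeS : forall i j, In i S2 -> In j S2 -> e (pi i) (pi j) = e' i j).
    { intros i j Hi Hj. unfold S2 in Hi, Hj. rewrite sel_In in Hi, Hj. apply He'2; tauto. }
    assert (Hsub : incl (inter S1 S2) S2) by (intros x Hx; apply inter_In in Hx; tauto).
    rewrite <- (delta_map m e e' pi S2), <- (delta_map m e e' pi (inter S1 S2)); auto.
    2: now apply NoDup_sel.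
    rewrite (delta_ext m e (map pi (inter S1 S2)) (inter (map pi S2) Z)); auto.
    - apply closed_inter_le; auto. now apply NoDup_map_in.
    - apply NoDup_map_in; auto. now apply NoDup_sel.
    - apply NoDup_sel. now apply NoDup_map_in.
    - intros x. rewrite inter_In, !in_map_iff. split.
      + intros [i [<- Hi]]. assert (Hi2 := Hsub i Hi). split; [eauto|].
        rewrite inter_In in Hi. unfold S1, S2 in Hi. rewrite !sel_In in Hi.
        assert (i < d) by lia. unfold pi. rewrite Hr1 by lia. auto.
      + intros [[i [<- Hi]] HxZ]. exists i. split; auto. rewrite inter_In. split; auto.
        unfold S1, S2 in *. rewrite sel_In in *. destruct Hi as [Hi [Hi'|Hi']]; [split; auto; lia|].
        exfalso. assert (HP : In (pi i) P).
        { unfold pi. rewrite Hr2 by auto. apply HnP. apply HSn in Hi. unfold n in Hi. lia. }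
        unfold P in HP. rewrite diff_In in HP. tauto. }
  assert (Hpi1 : forall i j, i < d + p -> j < d + p -> pi i = pi j -> i = j).
  { intros i j Hi Hj E. apply Hpi in E; rewrite ?Hr1 in *; auto. }
  destruct Hgen as [_ [Hpos [_ [_ Huniv]]]].
  destruct (Huniv n e') as [f0 [Hf0 [Hfe Hfc]]].
  { split; [intros; apply He'|]. split; [intros; apply He'|].
    intros S HS HSn. eapply Z.le_trans; [|apply Hle; auto].
    rewrite <- (delta_map m e e' pi); auto.
    - apply Hpos. apply NoDup_map_in; [|now apply NoDup_sel].
      intros i j. rewrite !sel_In. intros Hi Hj. apply Hpi1; tauto.
    - now apply NoDup_sel.
    - intros i j. rewrite !sel_In. intros Hi Hj. apply Hpi1; tauto.
    - intros i j. rewrite !sel_In. intros Hi Hj. apply He'1; tauto. }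
  set (A1 := map f0 (seq 0 (d + p))).
  assert (HA1 : closed_M m e A1).
  { apply closed_M_iff. split.
    { apply NoDup_map_in; [|apply seq_NoDup]. intros i j. rewrite !in_seq. intros Hi Hj.
      apply Hf0; unfold n; lia. }
    intros B HB HAB.
    eapply Z.le_trans; [|apply (closed_inter_le m e (map f0 (seq 0 n)) B); auto].
    set (S := sel (fun i => In (f0 i) B) (seq 0 n)).
    assert (HSn : forall i, In i S -> i < n).
    { intros i Hi. unfold S in Hi. rewrite sel_In, in_seq in Hi. lia. }
    assert (NS : NoDup S) by (apply NoDup_sel, seq_NoDup).
    rewrite (delta_ext m e (inter B (map f0 (seq 0 n))) (map f0 S)); auto.
    - rewrite (delta_map m e e' f0 S); auto.
      eapply Z.le_trans; [|apply Hle; auto].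
      rewrite (delta_ext m e' _ (seq 0 (d + p))); auto.
      + unfold A1. rewrite (delta_map m e e' f0); auto; [lia|apply seq_NoDup| |];
          intros i j; rewrite !in_seq; intros Hi Hj; [apply Hf0|apply Hfe]; unfold n; lia.
      + now apply NoDup_sel.
      + apply seq_NoDup.
      + intros i. unfold S. rewrite !sel_In, !in_seq. split; [lia|]. intros Hi.
        split; [split|]; try (unfold n; lia). apply HAB. unfold A1. apply in_map. apply in_seq. lia.
    - now apply NoDup_sel.
    - apply NoDup_map_in; auto.
    - intros x. rewrite inter_In, !in_map_iff. unfold S. split.
      + intros [HxB [i [<- Hi]]]. exists i. rewrite sel_In. auto.
      + intros [i [<- Hi]]. rewrite sel_In in Hi. split; [tauto|]. exists i. tauto. }
  assert (Hidx : forall y, exists i, (exists j, j < n /\ f0 j = y) -> i < n /\ f0 i = y).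
  { intros y. destruct (classic (exists j, j < n /\ f0 j = y)) as [[j Hj]|H].
    - eauto.
    - exists 0. tauto. }
  destruct (choice_fun _ Hidx) as [ix Hix].
  assert (Hix' : forall i, i < n -> ix (f0 i) = i).
  { intros i Hi. destruct (Hix (f0 i)); [eauto|]. apply Hf0; auto. }
  (* Homogeneity moves the embedded first copy onto [Y]; the same automorphism then takes the second
     copy to the required free copy. *)
  destruct (gen_homogeneous A1 Y (fun y => pi (ix y))) as [ga [[Gi [Gs Ge]] Hga]]; auto.
  { unfold A1. rewrite map_map. rewrite (map_ext_in _ (fun i => nth i L 0)).
    - apply NoDup_Permutation; auto.
      + apply NoDup_map_in; [|apply seq_NoDup]. intros i j. rewrite !in_seq. intros Hi Hj E.
        apply (proj1 (NoDup_nth L 0) NL); auto; lia.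
      + intros x. rewrite <- HLY, in_map_iff. split.
        * intros [i [<- Hi]]. apply nth_In. apply in_seq in Hi. lia.
        * intros Hx. apply (In_nth L x 0) in Hx. destruct Hx as [i [Hi <-]].
          exists i. split; auto. apply in_seq. lia.
    - intros i Hi. apply in_seq in Hi. unfold pi. rewrite Hix' by (unfold n; lia). rewrite Hr1; auto. lia. }
  { intros x y Hx Hy. unfold A1 in Hx, Hy. apply in_map_iff in Hx, Hy.
    destruct Hx as [i [<- Hi]], Hy as [j [<- Hj]]. apply in_seq in Hi, Hj.
    rewrite !Hix' by (unfold n; lia). rewrite He'1 by lia. symmetry. apply Hfe; unfold n; lia. }
  assert (Hga1 : forall i, i < d + p -> ga (f0 i) = nth i L 0).
  { intros i Hi. rewrite Hga.
    - unfold pi. rewrite Hix' by (unfold n; lia). now rewrite Hr1.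
    - unfold A1. apply in_map. apply in_seq. lia. }
  assert (Hio : forall x, exists i, In x Y -> i < d + p /\ nth i L 0 = x).
  { intros x. destruct (classic (In x Y)) as [Hx|Hx]; [|exists 0; tauto].
    rewrite <- HLY in Hx. apply (In_nth L x 0) in Hx. destruct Hx as [i [Hi E]].
    exists i. split; auto. lia. }
  destruct (choice_fun _ Hio) as [io Hio'].
  assert (HioP : forall x, In x Y -> ~ In x Z -> d <= io x).
  { intros x Hx HxZ. apply Nat.nlt_ge. intros H. apply HxZ.
    destruct (Hio' x Hx) as [_ <-]. auto. }
  assert (HioZ : forall x, In x Z -> io x < d).
  { intros x Hx. apply Nat.nle_gt. intros H. destruct (Hio' x (HZY x Hx)) as [H1 H2].
    assert (HP : In x P) by (rewrite <- H2; apply HnP; lia).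
    unfold P in HP. rewrite diff_In in HP. tauto. }
  set (ii := fun x => if in_dec_c x Z then io x else io x + p).
  assert (Hii : forall x, In x Y -> ii x < n /\ (ii x < d \/ d + p <= ii x) /\ pi (ii x) = x).
  { intros x Hx. destruct (Hio' x Hx) as [H1 H2]. unfold ii. destruct (in_dec_c x Z) as [H|H].
    - specialize (HioZ x H). unfold pi. rewrite Hr1 by lia. unfold n. repeat split; auto; lia.
    - specialize (HioP x Hx H). unfold pi. rewrite Hr2 by lia. unfold n.
      replace (io x + p - p) with (io x) by lia. repeat split; auto; lia. }
  exists (fun x => ga (f0 (ii x))). split; [|split; [|split]].
  - intros x Hx. unfold ii. destruct (in_dec_c x Z); [|tauto].
    destruct (Hio' x (HZY x Hx)) as [H1 H2]. rewrite Hga1; auto.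
  - intros x y Hx Hy E. apply Gi in E. destruct (Hii x Hx) as [h1 [h2 h3]], (Hii y Hy) as [k1 [k2 k3]].
    apply Hf0 in E; auto. congruence.
  - intros x y Hx Hy. destruct (Hii x Hx) as [h1 [h2 h3]], (Hii y Hy) as [k1 [k2 k3]].
    rewrite Ge, Hfe by auto. rewrite <- He'2 by auto. congruence.
  - intros x Hx HxZ HY'. set (y := ga (f0 (ii x))) in *.
    destruct (Hio' y HY') as [H1 H2]. rewrite <- Hga1 in H2 by auto.
    unfold y in H2 at 2. apply Gi in H2. destruct (Hii x Hx) as [h1 _].
    apply Hf0 in H2; auto; [|unfold n; lia].
    unfold ii in H2. destruct (in_dec_c x Z); [tauto|]. specialize (HioP x Hx HxZ). lia.
Qed.

End FreeAmalgam.

(** * The geometric closure is layered *)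

Section GeometricClosure.

Context {m : nat} {e : nat -> nat -> bool}.
Hypothesis Hgen : is_generic m e.
Context {A C0 : list nat}.
Hypothesis HC0 : is_cl m e A C0.

(** The finite sets of dimension zero over [C0]; by [gcl_iff] their union is the geometric
    closure. *)
Definition zero_ext (B : list nat) := NoDup B /\ incl C0 B /\ delta m e B = delta m e C0.

Definition gcl := in_gcl m e (fun a => In a A).

Lemma base_min B : NoDup B -> incl C0 B -> (delta m e C0 <= delta m e B)%Z.
Proof. apply (proj2 (proj1 (closed_M_iff m e C0) (proj1 HC0))). Qed.

Lemma zero_ext_base : zero_ext C0.
Proof. split; [exact (proj1 (proj1 HC0))|]. split; [apply incl_refl|reflexivity]. Qed.

Lemma zero_ext_closed B : zero_ext B -> closed_M m e B.
Proof.
  intros [HB [HCB E]]. apply closed_M_iff. split; auto. intros D HD HBD. rewrite E.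
  apply base_min; auto. eapply incl_tran; eauto.
Qed.

Lemma zero_ext_ext B B' : zero_ext B -> NoDup B' -> (forall x, In x B <-> In x B') -> zero_ext B'.
Proof.
  intros [HB [HCB E]] HB' H. split; auto. split.
  - intros x Hx. apply H; auto.
  - rewrite <- E. symmetry. now apply delta_ext; [apply (gen_graph Hgen)| | |].
Qed.

(** Union and intersection have predimension at least that of [C0], and the modular law bounds their
    sum by twice that value; so both bounds are attained and no edge crosses. *)
Lemma zero_ext_modular B D : zero_ext B -> zero_ext D ->
  zero_ext (union B D) /\ zero_ext (inter B D) /\
  forall x y, In x B -> ~ In x D -> In y D -> ~ In y B -> e x y = false.
Proof.
  intros [HB [HCB EB]] [HD [HCD ED]].
  pose proof (delta_modular m e B D (gen_graph Hgen) HB HD) as Hm.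
  assert (NU : NoDup (union B D)) by now apply NoDup_union.
  assert (NI : NoDup (inter B D)) by now apply NoDup_sel.
  assert (IU : incl C0 (union B D)) by (intros x Hx; apply union_In; auto).
  assert (II : incl C0 (inter B D)) by (intros x Hx; apply inter_In; auto).
  pose proof (base_min _ NU IU). pose proof (base_min _ NI II).
  split; [|split].
  - split; auto. split; auto. lia.
  - split; auto. split; auto. lia.
  - intros x y HxB HxD HyD HyB.
    apply (proj1 (cross_zero e (diff B D) (diff D B))); [lia| |]; apply diff_In; auto.
Qed.

Lemma zero_ext_map f B : zero_ext B -> (forall x, In x C0 -> f x = x) ->
  (forall x y, In x B -> In y B -> f x = f y -> x = y) ->
  (forall x y, In x B -> In y B -> e (f x) (f y) = e x y) -> zero_ext (map f B).
Proof.
  intros [HB [HCB E]] Hf Hinj He. split; [now apply NoDup_map_in|]. split.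
  - intros x Hx. rewrite <- (Hf x Hx). apply in_map; auto.
  - rewrite (delta_map m e e f B); auto; apply (gen_graph Hgen).
Qed.

(** For closures [C] and [C'] of equal predimension, submodularity makes [union C0 C'] a zero
    extension, because [inter C0 C'] contains the closed set [C]. Conversely, the closure of
    [x :: A] lies between [C0] and any zero extension containing [x]. *)
Lemma gcl_iff x : gcl x <-> exists B, zero_ext B /\ In x B.
Proof.
  pose proof (gen_graph Hgen) as He.
  destruct HC0 as [HC0c [HAC HC0m]]. split.
  - intros [A0 [C [C' [HA0 [[HC [HAC1 HCm]] [[HC' [HAC' _]] E]]]]]].
    assert (HCC0 : incl C C0) by (apply HCm; auto; intros a Ha; auto).
    assert (HCC' : incl C C').
    { apply HCm; auto. intros a Ha. apply HAC'. simpl; auto. }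
    pose proof (proj1 (closed_M_iff m e C) HC) as [NC HCle].
    assert (NC0 : NoDup C0) by exact (proj1 HC0c).
    assert (NC' : NoDup C') by exact (proj1 HC').
    exists (union C0 C'). split.
    + assert (NU : NoDup (union C0 C')) by now apply NoDup_union.
      assert (IU : incl C0 (union C0 C')) by (intros y Hy; apply union_In; auto).
      split; auto. split; auto.
      pose proof (base_min _ NU IU).
      pose proof (delta_modular m e C0 C' He NC0 NC').
      assert (delta m e C <= delta m e (inter C0 C'))%Z.
      { apply HCle; [now apply NoDup_sel|]. intros y Hy. apply inter_In; auto. }
      lia.
    + apply union_In. right. apply HAC'. simpl; auto.
  - intros [B [HB Hx]].
    destruct (cl_exists Hgen (x :: A)) as [C' HC'].
    exists A, C0, C'. split; auto. split; [split; auto|]. split; auto.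
    destruct HC' as [HC' [HAC' HCm']].
    assert (HBc : incl C' B).
    { apply HCm'; [now apply zero_ext_closed|]. intros y [<-|Hy]; auto. apply HB. auto. }
    assert (HC0' : incl C0 C').
    { apply HC0m; auto. intros y Hy. apply HAC'. simpl; auto. }
    pose proof (proj1 (closed_M_iff m e C') HC') as [NC' HCle].
    pose proof (base_min _ NC' HC0').
    destruct HB as [NB [_ EB]].
    pose proof (HCle B NB HBc). lia.
Qed.

(** A shortest zero extension containing [x] lies in all others, by intersecting. Keeping [gcl x]
    under the existential makes [least_zext] total. *)
Lemma least_zext_exists x : exists B, gcl x ->
  zero_ext B /\ In x B /\ forall D, zero_ext D -> In x D -> incl B D.
Proof.
  destruct (classic (gcl x)) as [Hx|Hx]; [|exists []; tauto].
  apply gcl_iff in Hx. destruct Hx as [B HB].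
  remember (length B) as n eqn:En. revert B En HB.
  induction n as [n IH] using lt_wf_ind. intros B -> [HB HxB].
  destruct (classic (exists D, zero_ext D /\ In x D /\ ~ incl B D)) as [[D [HD [HxD Hn]]]|Hn].
  - apply (IH (length (inter B D))) with (B := inter B D); auto.
    + apply Nat.nle_gt. intros Hl. apply Hn. intros y Hy.
      assert (Hi : incl B (inter B D)).
      { apply (NoDup_length_incl (NoDup_sel _ _ (proj1 HB)) Hl).
        intros z Hz. apply inter_In in Hz. tauto. }
      apply Hi, inter_In in Hy. tauto.
    + split; [now apply zero_ext_modular|]. apply inter_In; auto.
  - exists B. intros _. split; auto. split; auto. intros D HD HxD.
    apply NNPP. intros H. apply Hn. eauto.
Qed.

Definition least_zext x := proj1_sig (constructive_indefinite_description _ (least_zext_exists x)).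

Lemma least_zext_spec x : gcl x -> zero_ext (least_zext x) /\ In x (least_zext x) /\ forall D, zero_ext D -> In x D -> incl (least_zext x) D.
Proof. unfold least_zext. destruct (constructive_indefinite_description _ _); auto. Qed.

Lemma zero_ext_gcl B x : zero_ext B -> In x B -> gcl x.
Proof. intros HB Hx. apply gcl_iff. eauto. Qed.

Lemma least_zext_union l : (forall x, In x l -> gcl x) ->
  exists B, zero_ext B /\ forall x, In x B <-> In x C0 \/ exists y, In y l /\ In x (least_zext y).
Proof.
  induction l as [|a l IH]; intros Hl.
  - exists C0. split; [apply zero_ext_base|]. intros x. split; auto. intros [H|[y [[] _]]]; auto.
  - destruct IH as [B [HB HBi]]; [intros; apply Hl; simpl; auto|].
    destruct (least_zext_spec a) as [Ha _]; [apply Hl; simpl; auto|].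
    exists (union (least_zext a) B). split; [now apply zero_ext_modular|].
    intros x. rewrite union_In, HBi. split.
    + intros [H|[H|[y [Hy H]]]]; auto; right; [exists a|exists y]; simpl; auto.
    + intros [H|[y [[<-|Hy] H]]]; auto. right; right; eauto.
Qed.

(* Points of the base C0 are left out: the group below fixes them. *)
Definition point := {x : nat | gcl x /\ ~ In x C0}.
Definition vertex (t : point) : nat := proj1_sig t.

Lemma vertex_inj s t : vertex s = vertex t -> s = t.
Proof. apply eq_sig_hprop. intros; apply proof_irrelevance. Qed.

Definition point_of (x : nat) : list point :=
  match excluded_middle_informative (gcl x /\ ~ In x C0) with
  | left H => [exist _ x H]
  | right _ => []
  end.

Lemma point_of_In t x : In t (point_of x) <-> vertex t = x.
Proof.
  unfold point_of. destruct (excluded_middle_informative _) as [H|H]; simpl.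
  - split; [intros [<-|[]]; auto|]. intros E. left. apply vertex_inj. auto.
  - split; [tauto|]. intros <-. apply H. exact (proj2_sig t).
Qed.

Definition points_of (l : list nat) : list point := flat_map point_of l.

Lemma points_of_In t l : In t (points_of l) <-> In (vertex t) l.
Proof.
  unfold points_of. rewrite in_flat_map. split.
  - intros [x [Hx Ht]]. apply point_of_In in Ht. now subst.
  - intros H. exists (vertex t). split; auto. now apply point_of_In.
Qed.

Lemma points_of_NoDup l : NoDup l -> NoDup (points_of l).
Proof.
  intros H. induction H as [|a l Ha H IH]; simpl; [constructor|].
  apply NoDup_app; auto.
  - unfold point_of. destruct (excluded_middle_informative _); repeat constructor. simpl; tauto.
  - intros t Ht Ht'. apply point_of_In in Ht. apply points_of_In in Ht'. now subst.
Qed.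

Definition below (t : point) : list point := points_of (least_zext (vertex t)).

Lemma vertex_gcl t : gcl (vertex t).
Proof. apply (proj2_sig t). Qed.

Lemma vertex_not_base t : ~ In (vertex t) C0.
Proof. apply (proj2_sig t). Qed.

Lemma below_In s t : In s (below t) <-> In (vertex s) (least_zext (vertex t)).
Proof. apply points_of_In. Qed.

Definition lift (f : point -> point) (x : nat) : nat :=
  match excluded_middle_informative (gcl x /\ ~ In x C0) with
  | left H => vertex (f (exist _ x H))
  | right _ => x
  end.

Lemma lift_vertex f t : lift f (vertex t) = vertex (f t).
Proof.
  unfold lift. destruct (excluded_middle_informative _) as [H|H].
  - f_equal. f_equal. now apply vertex_inj.
  - destruct H. exact (proj2_sig t).
Qed.

Lemma lift_base f x : In x C0 -> lift f x = x.
Proof. intros H. unfold lift. destruct (excluded_middle_informative _) as [Hx|Hx]; [exfalso; tauto|reflexivity]. Qed.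

Lemma gcl_cases x : gcl x -> In x C0 \/ exists t, vertex t = x.
Proof.
  intros H. destruct (classic (In x C0)) as [H'|H']; auto. right.
  now exists (exist _ x (conj H H')).
Qed.

Lemma base_gcl x : In x C0 -> gcl x.
Proof. apply zero_ext_gcl, zero_ext_base. Qed.

Lemma lift_gcl f x : gcl x -> gcl (lift f x).
Proof.
  intros Hx. destruct (gcl_cases x Hx) as [H|[t <-]].
  - now rewrite lift_base.
  - rewrite lift_vertex. apply vertex_gcl.
Qed.

Lemma lift_comp f g x : gcl x -> lift (fun t => f (g t)) x = lift f (lift g x).
Proof.
  intros Hx. destruct (gcl_cases x Hx) as [H|[t <-]].
  - rewrite (lift_base g x H), !lift_base by auto. reflexivity.
  - now rewrite !lift_vertex.
Qed.

Lemma lift_id x : lift (fun t => t) x = x.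
Proof. unfold lift. destruct (excluded_middle_informative _); auto. Qed.

Lemma lift_pinv (p : perm point) x : gcl x -> lift p (lift (pinv p) x) = x.
Proof.
  intros Hx. rewrite <- lift_comp by auto. rewrite <- (lift_id x) at 2. f_equal.
  apply functional_extensionality. intros t. apply pinvVK.
Qed.

Lemma lift_inj (p : perm point) x y : gcl x -> gcl y -> lift p x = lift p y -> x = y.
Proof.
  intros Hx Hy E. apply (f_equal (lift (pinv p))) in E.
  rewrite <- (lift_pinv (pinv p) x), <- (lift_pinv (pinv p) y); auto.
Qed.

Definition base_aut (p : perm point) := forall x y, gcl x -> gcl y -> e (lift p x) (lift p y) = e x y.

Lemma base_aut_zero_ext p B : base_aut p -> zero_ext B -> zero_ext (map (lift p) B).
Proof.
  intros Hp HB. apply zero_ext_map; auto.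
  - apply lift_base.
  - intros x y Hx Hy. apply lift_inj; eapply zero_ext_gcl; eauto.
  - intros x y Hx Hy. apply Hp; eapply zero_ext_gcl; eauto.
Qed.

Lemma base_aut_inv p : base_aut p -> base_aut (pinv p).
Proof.
  intros Hp x y Hx Hy.
  rewrite <- (Hp (lift (pinv p) x) (lift (pinv p) y)) by now apply lift_gcl.
  now rewrite !lift_pinv.
Qed.

(** The inverse of [p] carries the least zero extension at [p t] to a zero extension containing [t],
    which includes the least one. *)
Lemma base_aut_below p s t : base_aut p -> In s (below t) -> In (p s) (below (p t)).
Proof.
  intros Hp H. apply below_In in H. apply below_In.
  destruct (least_zext_spec (vertex (p t)) (vertex_gcl _)) as [HB [HtB _]].
  destruct (least_zext_spec (vertex t) (vertex_gcl _)) as [_ [_ Hmin]].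
  apply (Hmin (map (lift (pinv p)) (least_zext (vertex (p t))))) in H.
  - apply in_map_iff in H. destruct H as [x [E Hx]].
    assert (HxX : gcl x) by (eapply zero_ext_gcl; eauto).
    rewrite <- lift_vertex, <- E. now rewrite lift_pinv.
  - apply base_aut_zero_ext; auto. now apply base_aut_inv.
  - apply in_map_iff. exists (vertex (p t)). split; auto. rewrite lift_vertex. f_equal. apply pinvK.
Qed.

(** [ga] and its inverse map zero extensions to zero extensions, hence preserve the geometric
    closure. *)
Lemma automorphism_restricts ga : is_automorphism e ga -> (forall x, In x C0 -> ga x = x) ->
  exists p, base_aut p /\ forall t, vertex (p t) = ga (vertex t).
Proof.
  intros [Gi [Gs Ge]] Hf. destruct (choice_fun _ Gs) as [gb Hgb].
  assert (Hga : forall x, gb (ga x) = x) by (intros x; apply Gi; apply Hgb).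
  assert (HX : forall x, gcl x -> gcl (ga x)).
  { intros x Hx. apply gcl_iff in Hx. destruct Hx as [B [HB Hx]]. apply gcl_iff.
    exists (map ga B). split; [apply zero_ext_map; auto|now apply in_map]. }
  assert (Hfb : forall x, In x C0 -> gb x = x).
  { intros x Hx. rewrite <- (Hf x Hx) at 1. apply Hga. }
  assert (HXb : forall x, gcl x -> gcl (gb x)).
  { intros x Hx. apply gcl_iff in Hx. destruct Hx as [B [HB Hx]]. apply gcl_iff.
    exists (map gb B). split; [apply zero_ext_map; auto|now apply in_map].
    - intros y z _ _ E. rewrite <- (Hgb y), <- (Hgb z). now f_equal.
    - intros y z _ _. rewrite <- Ge. now rewrite !Hgb. }
  assert (H1 : forall t : point, gcl (ga (vertex t)) /\ ~ In (ga (vertex t)) C0).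
  { intros t. split; [apply HX, vertex_gcl|]. intros H. apply (vertex_not_base t).
    rewrite <- (Hga (vertex t)). now rewrite Hfb. }
  assert (H2 : forall t : point, gcl (gb (vertex t)) /\ ~ In (gb (vertex t)) C0).
  { intros t. split; [apply HXb, vertex_gcl|]. intros H. apply (vertex_not_base t).
    rewrite <- (Hgb (vertex t)). now rewrite Hf. }
  assert (K1 : forall t : point, exist (fun x => gcl x /\ ~ In x C0) (gb (vertex (exist _ (ga (vertex t)) (H1 t)))) (H2 _) = t).
  { intros t. apply vertex_inj. simpl. apply Hga. }
  assert (K2 : forall t : point, exist (fun x => gcl x /\ ~ In x C0) (ga (vertex (exist _ (gb (vertex t)) (H2 t)))) (H1 _) = t).
  { intros t. apply vertex_inj. simpl. apply Hgb. }
  set (p := Perm (fun t : point => exist _ (ga (vertex t)) (H1 t) : point)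
                 (fun t : point => exist _ (gb (vertex t)) (H2 t) : point) K1 K2).
  exists p. split; [|reflexivity].
  assert (Hl : forall x, gcl x -> lift p x = ga x).
  { intros x Hx. destruct (gcl_cases x Hx) as [H|[t <-]].
    - rewrite lift_base, Hf; auto.
    - now rewrite lift_vertex. }
  intros x y Hx Hy. rewrite !Hl; auto.
Qed.

(** Zero extensions are closed in the generic graph, so homogeneity yields an automorphism, which is
    then restricted. *)
Lemma zero_ext_iso_extends f B : zero_ext B -> (forall x, In x C0 -> f x = x) ->
  (forall x y, In x B -> In y B -> f x = f y -> x = y) ->
  (forall x y, In x B -> In y B -> e (f x) (f y) = e x y) ->
  exists p, base_aut p /\ forall t, In (vertex t) B -> vertex (p t) = f (vertex t).
Proof.
  intros HB Hf Hinj He.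
  destruct (gen_homogeneous Hgen B (map f B) f) as [ga [Hga Hag]]; auto.
  - now apply zero_ext_closed.
  - now apply zero_ext_closed, zero_ext_map.
  - destruct (automorphism_restricts ga Hga) as [p [Hp Hpv]].
    + intros x Hx. rewrite Hag; [auto|]. apply HB; auto.
    + exists p. split; auto. intros t Ht. rewrite Hpv. auto.
Qed.

Definition span (D : list point) := C0 ++ map vertex (nodup eq_dec_c D).

Lemma span_In D x : In x (span D) <-> In x C0 \/ exists t, In t D /\ vertex t = x.
Proof.
  unfold span. rewrite in_app_iff, in_map_iff. split; intros [H|[t H]]; auto; right; exists t;
  rewrite nodup_In in *; tauto.
Qed.

Lemma zero_ext_span D : (forall t, In t D -> incl (below t) D) -> zero_ext (span D).
Proof.
  intros HD. destruct (least_zext_union (map vertex D)) as [B [HB HBi]].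
  { intros x Hx. apply in_map_iff in Hx. destruct Hx as [t [<- _]]. apply vertex_gcl. }
  apply (zero_ext_ext B); auto.
  - apply NoDup_app.
    + apply zero_ext_base.
    + apply NoDup_map_in; [|apply NoDup_nodup]. intros s t _ _. apply vertex_inj.
    + intros x Hx Hx'. apply in_map_iff in Hx'. destruct Hx' as [t [<- _]]. now apply (vertex_not_base t).
  - intros x. rewrite HBi, span_In. split.
    + intros [H|[y [Hy Hx]]]; auto. apply in_map_iff in Hy. destruct Hy as [t [<- Ht]].
      destruct (gcl_cases x) as [H|[s <-]]; auto.
      { eapply zero_ext_gcl; [|apply Hx]. apply least_zext_spec, vertex_gcl. }
      right. exists s. split; auto. apply (HD t Ht). now apply below_In.
    + intros [H|[t [Ht <-]]]; auto. right. exists (vertex t). split; [now apply in_map|].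
      apply least_zext_spec, vertex_gcl.
Qed.

(** Each vertex is missing from the least zero extension of the other, and zero extensions have no
    edges across. *)
Lemma incomparable_no_edge s t : ~ In s (below t) -> ~ In t (below s) -> e (vertex s) (vertex t) = false.
Proof.
  rewrite !below_In. intros H1 H2.
  destruct (least_zext_spec (vertex s) (vertex_gcl s)) as [Hs [Hss _]].
  destruct (least_zext_spec (vertex t) (vertex_gcl t)) as [Ht [Htt _]].
  apply (proj2 (proj2 (zero_ext_modular _ _ Hs Ht))); auto.
Qed.

Lemma base_aut_comp p q : base_aut p -> base_aut q -> base_aut (p ** q).
Proof.
  intros Hp Hq x y Hx Hy. change (e (lift (fun t => p (q t)) x) (lift (fun t => p (q t)) y) = e x y).
  rewrite (lift_comp p q x), (lift_comp p q y) by auto. rewrite Hp by now apply lift_gcl. auto.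
Qed.

(** Extended by the identity on [C0], [f] embeds the zero extension [span D]: edges to the base or
    between comparable points are preserved by the local automorphisms, while incomparable points
    carry no edge and stay incomparable. *)
Lemma base_aut_homogeneous D (f : point -> point) :
  (forall t, In t D -> incl (below t) D) ->
  (forall s t, In s D -> In t D -> f s = f t -> s = t) ->
  (forall t, In t D -> exists g, base_aut g /\ forall s, In s (below t) -> f s = g s) ->
  exists g, base_aut g /\ forall t, In t D -> f t = g t.
Proof.
  intros HD Hinj Hloc.
  assert (Hself : forall t, In t (below t)) by (intros t; apply below_In, least_zext_spec, vertex_gcl).
  assert (Hcomp : forall s t, In t D -> In s (below t) ->
    e (vertex (f s)) (vertex (f t)) = e (vertex s) (vertex t)).
  { intros s t Ht Hs. destruct (Hloc t Ht) as [g [Hg Eg]]. rewrite !Eg by auto.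
    rewrite <- !lift_vertex. apply Hg; apply vertex_gcl. }
  (* The local automorphism at [t] pulls [f s] back to a point of [below t], which is [s] by
     injectivity. *)
  assert (Hdn : forall s t, In s D -> In t D -> In (f s) (below (f t)) -> In s (below t)).
  { intros s t Hs Ht H. destruct (Hloc t Ht) as [g [Hg Eg]].
    assert (Hr : In (pinv g (f s)) (below t)).
    { rewrite <- (pinvK g t). apply base_aut_below; [now apply base_aut_inv|]. now rewrite <- (Eg t). }
    assert (E : f (pinv g (f s)) = f s) by (rewrite Eg by auto; apply pinvVK).
    apply Hinj in E; auto; [now rewrite <- E|]. apply (HD t Ht); auto. }
  pose proof (gen_graph Hgen) as [Hsym _].
  destruct (zero_ext_iso_extends (lift f) (span D)) as [p [Hp Epv]].
  - now apply zero_ext_span.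
  - apply lift_base.
  - intros x y Hx Hy. rewrite span_In in Hx, Hy.
    destruct Hx as [Hx|[s [Hs <-]]], Hy as [Hy|[t [Ht <-]]];
      rewrite ?lift_vertex, ?lift_base by auto; auto; intros E.
    + exfalso. apply (vertex_not_base (f t)). now rewrite <- E.
    + exfalso. apply (vertex_not_base (f s)). now rewrite E.
    + f_equal. apply Hinj; auto. now apply vertex_inj.
  - intros x y Hx Hy. rewrite span_In in Hx, Hy.
    assert (HCt : forall x t, In x C0 -> In t D -> e x (vertex (f t)) = e x (vertex t)).
    { intros z t Hz Ht. destruct (Hloc t Ht) as [g [Hg Eg]]. rewrite Eg by auto.
      rewrite <- lift_vertex. rewrite <- (lift_base g z Hz) at 1. apply Hg; [now apply base_gcl|apply vertex_gcl]. }
    destruct Hx as [Hx|[s [Hs <-]]], Hy as [Hy|[t [Ht <-]]];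
      rewrite ?lift_vertex, ?lift_base by auto; auto.
    + rewrite Hsym, (Hsym (vertex s)). auto.
    + destruct (classic (In s (below t))) as [H|H]; auto.
      destruct (classic (In t (below s))) as [H'|H'].
      * rewrite Hsym, (Hsym (vertex s)). auto.
      * rewrite !incomparable_no_edge; auto.
  - exists p. split; auto. intros t Ht. apply vertex_inj. rewrite Epv.
    + now rewrite lift_vertex.
    + apply span_In. eauto.
Qed.

(** A zero extension [Y] containing [D] and [E] has a free copy over [span D], whose new points
    avoid [Y]. *)
Lemma base_aut_moves D E : (forall t, In t D -> incl (below t) D) ->
  exists g, base_aut g /\ fixes D g /\ forall t, In t E -> ~ In t D -> ~ In (g t) E.
Proof.
  intros HD.
  destruct (least_zext_union (map vertex (D ++ E))) as [Y [HY HYi]].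
  { intros x Hx. apply in_map_iff in Hx. destruct Hx as [t [<- _]]. apply vertex_gcl. }
  assert (HDEY : forall t, In t (D ++ E) -> In (vertex t) Y).
  { intros t Ht. apply HYi. right. exists (vertex t). split; [now apply in_map|]. apply least_zext_spec, vertex_gcl. }
  assert (HZ : zero_ext (span D)) by now apply zero_ext_span.
  assert (HZY : incl (span D) Y).
  { intros x Hx. apply span_In in Hx. destruct Hx as [Hx|[t [Ht <-]]].
    - now apply HY.
    - apply HDEY, in_app_iff; auto. }
  destruct (free_copy Hgen (span D) Y) as [f [F1 [F2 [F3 F4]]]]; auto; try now apply zero_ext_closed.
  destruct (zero_ext_iso_extends f Y) as [p [Hp Hpv]]; auto.
  { intros x Hx. apply F1, span_In; auto. }
  exists p. split; auto. split.
  - intros t Ht. apply vertex_inj. rewrite Hpv by (apply HDEY, in_app_iff; auto).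
    apply F1, span_In. eauto.
  - intros t Ht HtD HpE. apply (F4 (vertex t)).
    + apply HDEY, in_app_iff; auto.
    + rewrite span_In. intros [H|[s [Hs E']]]; [now apply (vertex_not_base t)|].
      apply vertex_inj in E'. now subst.
    + rewrite <- Hpv by (apply HDEY, in_app_iff; auto). apply HDEY, in_app_iff; auto.
Qed.

Lemma gcl_layered : layered vertex below base_aut.
Proof.
  split.
  - apply vertex_inj.
  - intros t. apply points_of_NoDup. apply (least_zext_spec _ (vertex_gcl t)).
  - intros t. apply below_In, least_zext_spec, vertex_gcl.
  - intros t s Hs u Hu. rewrite below_In in *.
    apply (proj2 (proj2 (least_zext_spec _ (vertex_gcl s)))) with (D := least_zext (vertex t)) in Hu; auto.
    apply least_zext_spec, vertex_gcl.
  - intros x y _ _. now rewrite !lift_id.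
  - apply base_aut_comp.
  - apply base_aut_inv.
  - intros g t s. apply base_aut_below.
  - apply base_aut_homogeneous.
  - apply base_aut_moves.
  (* Preserving an edge concerns two vertices only, so approximation on these suffices. *)
  - intros g Hg x y Hx Hy.
    destruct (Hg (points_of [x; y])) as [h [Hh Ah]].
    assert (El : forall z, gcl z -> z = x \/ z = y -> lift g z = lift h z).
    { intros z Hz Hzxy. destruct (gcl_cases z Hz) as [H|[t <-]].
      - now rewrite !lift_base.
      - rewrite !lift_vertex. f_equal. apply Ah. apply points_of_In. simpl. intuition. }
    rewrite !El; auto.
Qed.

(** Squeezing [Gs] between the stabiliser of [C0] and the full automorphism group covers both claims
    of the theorem. Distinct cosets of the trace of [H] on the stabiliser are distinct cosets of
    [H], so [layered_small_index] applies to the trace; its finite set together with [C0] witnesses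
    openness. *)
Lemma gcl_small_index (Gs : (nat -> nat) -> Prop) :
  (forall g, Gs g -> is_aut_on e gcl g) ->
  (forall g, is_aut_on e gcl g -> (forall x, In x C0 -> g x = x) -> Gs g) ->
  small_index_property gcl Gs.
Proof.
  intros Hsub Hsup H [HHG [HHext [HHid [HHcomp HHinv]]]] Hsmall.
  assert (HGs : forall p, base_aut p -> Gs (lift p)).
  { intros p Hp. apply Hsup; [|apply lift_base]. split; [apply lift_gcl|]. split; [apply lift_inj|].
    split; auto. intros y Hy. exists (lift (pinv p) y). split; [now apply lift_gcl|]. now apply lift_pinv. }
  destruct (@layered_small_index point vertex below base_aut gcl_layered (fun p => H (lift p))) as [F HF].
  - intros p q Hp Hq. apply (HHext (fun x => lift p (lift q x))); auto.
    intros x Hx. symmetry. exact (lift_comp p q x Hx).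
  - intros p Hp. destruct (HHinv _ Hp) as [h [Hh Eh]]. apply (HHext h); auto.
    intros x Hx. destruct (Hsub h (HHG h Hh)) as [HhX _].
    apply (lift_inj p); auto; [now apply lift_gcl|]. rewrite lift_pinv by auto. now apply Eh.
  - intros [phi [Hphi Hsep]]. apply Hsmall. exists (fun s => lift (phi s)). split; auto.
    intros s t Hst [h [Hh Eh]]. apply (Hsep s t Hst). apply (HHext h); auto.
    intros x Hx. destruct (Hsub h (HHG h Hh)) as [HhX _].
    apply (lift_inj (phi s)); auto; [now apply lift_gcl|].
    change (lift (phi s) (h x) = lift (phi s) (lift (fun t' => pinv (phi s) (phi t t')) x)).
    rewrite (lift_comp (pinv (phi s)) (phi t)) by auto.
    rewrite lift_pinv by now apply lift_gcl. symmetry. now apply Eh.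
  - exists (C0 ++ map vertex F). split.
    { intros x Hx. apply in_app_iff in Hx. destruct Hx as [Hx|Hx]; [now apply base_gcl|].
      apply in_map_iff in Hx. destruct Hx as [t [<- _]]. apply vertex_gcl. }
    intros g Hg Hfix. destruct (Hsub g Hg) as [gX [gi [gs ge]]].
    assert (gC : forall x, In x C0 -> g x = x) by (intros; apply Hfix, in_app_iff; auto).
    assert (H1 : forall t : point, gcl (g (vertex t)) /\ ~ In (g (vertex t)) C0).
    { intros t. split; [apply gX, vertex_gcl|]. intros Hin. apply (vertex_not_base t).
      rewrite <- (gi (g (vertex t)) (vertex t)); auto; [apply gX|]; apply vertex_gcl. }
    assert (Hs : forall t : point, exists s : point, g (vertex s) = vertex t).
    { intros t. destruct (gs (vertex t) (vertex_gcl t)) as [x [Hx E]].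
      destruct (gcl_cases x Hx) as [Hc|[s <-]]; eauto.
      exfalso. apply (vertex_not_base t). rewrite <- E, gC; auto. }
    destruct (choice_fun _ Hs) as [b Hb].
    assert (K2 : forall t : point, exist (fun x => gcl x /\ ~ In x C0) (g (vertex (b t))) (H1 _) = t).
    { intros t. apply vertex_inj. simpl. apply Hb. }
    assert (K1 : forall t : point, b (exist _ (g (vertex t)) (H1 t)) = t).
    { intros t. apply vertex_inj. apply gi; try apply vertex_gcl. rewrite Hb. reflexivity. }
    (* A member of [Gs] fixing [C0] permutes the remaining points, so on the closure it is the lift
       of [p]. *)
    set (p := Perm (fun t : point => exist _ (g (vertex t)) (H1 t) : point) b K1 K2).
    assert (El : forall x, gcl x -> lift p x = g x).
    { intros x Hx. destruct (gcl_cases x Hx) as [Hc|[t <-]].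
      - rewrite lift_base, gC; auto.
      - now rewrite lift_vertex. }
    apply (HHext (lift p)); [|intros x Hx; auto]. apply HF.
    + intros x y Hx Hy. rewrite !El; auto.
    + intros t Ht. apply vertex_inj. simpl. apply Hfix. apply in_app_iff. right. now apply in_map.
Qed.

End GeometricClosure.

Theorem theorem6 :
  forall (m : nat) (e : nat -> nat -> bool) (A : list nat),
    (2 <= m)%nat -> is_generic m e ->
    small_index_property (in_gcl m e (fun a => In a A))
      (fun g => is_aut_on e (in_gcl m e (fun a => In a A)) g /\
                forall a, In a A -> g a = a) /\
    small_index_property (in_gcl m e (fun a => In a A))
      (is_aut_on e (in_gcl m e (fun a => In a A))).
Proof.
  intros m e A _ Hgen. destruct (cl_exists Hgen A) as [C0 HC0].
  split; apply (gcl_small_index Hgen HC0); auto.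
  - intros g Hg. apply Hg.
  - intros g Hg Hfix. split; auto. intros a Ha. apply Hfix. exact (proj1 (proj2 HC0) a Ha).
Qed.
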